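(* Let $z=(u,v,w)\in\mathcal{C}(\mathbb{R}^+;H^1(\mathbb{R})^3)$ be a weak solution of the three-component Camassa--Holm system which is $x$-symmetric, and suppose $z$ is the unique weak solution (i.e. any weak solution $\tilde z\in\mathcal{C}(\mathbb{R}^+;H^1(\mathbb{R})^3)$ with $\tilde z(t_0,\cdot)=z(t_0,\cdot)$ for some $t_0\ge0$ coincides with $z$). Then $z$ is a traveling wave, i.e. there exist $c\in\mathbb{R}$, $t_0\ge 0$ and a profile $Z$ such that $z(t,x)=Z(x-c(t-t_0))$ for all $t\ge0$ and a.e. $x$.
   Context: $\langle F,\phi\rangle=\int_{\mathbb{R}^+}\int_{\mathbb{R}}F\phi\,dx\,dt$. A function $z=(u,v,w)\in\mathcal{C}(\mathbb{R}^+;H^1(\mathbb{R})^3)$ is a weak solution if for all $\phi\in\mathcal{C}_0^\infty(\mathbb{R}^+\times\mathbb{R})$: $\langle u,(1-\partial_x^2)\phi_t\rangle+\langle u_x(v+w),\phi_{xx}\rangle-\frac12\langle u^2,\phi_{xxx}\rangle+\langle\frac32u^2+\frac12u_x^2+u(v+w)+u_x(v+w)_x+\frac12(v^2+w^2-v_x^2-w_x^2),\phi_x\rangle=0$, $\langle v,(1-\partial_x^2)\phi_t\rangle+\langle v_x(u+w),\phi_{xx}\rangle-\frac12\langle v^2,\phi_{xxx}\rangle+\langle\frac32v^2+\frac12v_x^2+v(u+w)+v_x(u+w)_x+\frac12(u^2+w^2-u_x^2-w_x^2),\phi_x\rangle=0$, $\langle w,(1-\partial_x^2)\phi_t\rangle+\langle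 w_x(u+v),\phi_{xx}\rangle-\frac12\langle w^2,\phi_{xxx}\rangle+\langle\frac32w^2+\frac12w_x^2+w(u+v)+w_x(u+v)_x+\frac12(u^2+v^2-u_x^2-v_x^2),\phi_x\rangle=0$. (This is the weak form of $m_t-m_xu+2mu_x+(mv+mw)_x+nv_x+lw_x=0$ and its two cyclic analogues, $m=u-u_{xx}$, $n=v-v_{xx}$, $l=w-w_{xx}$.) The solution $z$ is $x$-symmetric if there is $b\in\mathcal{C}^1(\mathbb{R}^+)$ such that $z(t,x)=z(t,2b(t)-x)$ for all $t\ge0$ and a.e. $x\in\mathbb{R}$. *)

(* Defs.v *)
From HB Require Import structures.
From mathcomp Require Import all_boot all_order all_algebra.
From mathcomp Require Import all_classical all_reals all_analysis.
Set Implicit Arguments. Unset Strict Implicit. Unset Printing Implicit Defensive.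
Import Order.TTheory GRing.Theory Num.Theory.
Import numFieldNormedType.Exports.
Local Open Scope classical_set_scope.
Local Open Scope ring_scope.

Section Defs.
Variable R : realType.

Definition smooth1 (f : R -> R) : Prop :=
  forall (n : nat) (x : R), derivable (iter n (@derive1 R R^o) f) x 1.

Definition cpt_support1 (f : R -> R) : Prop :=
  exists X : R, forall x : R, X < `|x| -> f x = 0.

Definition test1 (f : R -> R) : Prop := smooth1 f /\ cpt_support1 f.

Definition L2 (f : R -> R) : Prop :=
  measurable_fun setT f /\
  (@lebesgue_measure R).-integrable setT (fun x => ((f x) ^+ 2)%:E).

Definition weak_deriv (f g : R -> R) : Prop :=
  forall phi : R -> R, test1 phi ->
    Rintegral (@lebesgue_measure R) setT (fun x => f x * derive1 phi x)
    = - Rintegral (@lebesgue_measure R) setT (fun x => g x * phi x).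

Definition H1 (f g : R -> R) : Prop := L2 f /\ L2 g /\ weak_deriv f g.

Definition H1dist2 (f1 g1 f2 g2 : R -> R) : R :=
  Rintegral (@lebesgue_measure R) setT
    (fun x => (f1 x - f2 x) ^+ 2 + (g1 x - g2 x) ^+ 2).

Definition C_H1 (u ux : R -> R -> R) : Prop :=
  (forall t, 0 <= t -> H1 (u t) (ux t)) /\
  (forall t0, 0 <= t0 -> forall eps : R, 0 < eps -> exists delta : R, 0 < delta /\
     forall s, 0 <= s -> `|s - t0| < delta ->
       H1dist2 (u s) (ux s) (u t0) (ux t0) < eps).

Definition dt (f : R -> R -> R) : R -> R -> R :=
  fun t x => derive1 (fun s => f s x) t.
Definition dx (f : R -> R -> R) : R -> R -> R :=
  fun t x => derive1 (fun y => f t y) x.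

Definition Dw (w : seq bool) (f : R -> R -> R) : R -> R -> R :=
  foldr (fun b g => if b then dt g else dx g) f w.

Definition smooth2 (f : R -> R -> R) : Prop :=
  forall w : seq bool,
    continuous (fun p : R * R => Dw w f p.1 p.2) /\
    (forall t x, derivable (fun s => Dw w f s x) t 1 /\
                 derivable (fun y => Dw w f t y) x 1).

Definition test2 (phi : R -> R -> R) : Prop :=
  smooth2 phi /\
  exists T1 T2 X : R, 0 < T1 /\
    forall t x, (t < T1 \/ T2 < t \/ X < `|x|) -> phi t x = 0.

Definition pairing (F phi : R -> R -> R) : R :=
  Rintegral (@lebesgue_measure R) [set t | 0 <= t]
    (fun t => Rintegral (@lebesgue_measure R) setT (fun x => F t x * phi t x)).

Definition weak_eq (u v w ux vx wx : R -> R -> R) (phi : R -> R -> R) : Prop :=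
  pairing u (fun t x => dt phi t x - dx (dx (dt phi)) t x)
  + pairing (fun t x => ux t x * (v t x + w t x)) (dx (dx phi))
  - 2^-1 * pairing (fun t x => u t x ^+ 2) (dx (dx (dx phi)))
  + pairing (fun t x =>
        3 / 2 * u t x ^+ 2 + 2^-1 * ux t x ^+ 2 + u t x * (v t x + w t x)
        + ux t x * (vx t x + wx t x)
        + 2^-1 * (v t x ^+ 2 + w t x ^+ 2 - vx t x ^+ 2 - wx t x ^+ 2))
      (dx phi)
  = 0.

Definition weak_solution (u v w : R -> R -> R) : Prop :=
  exists ux vx wx : R -> R -> R,
    C_H1 u ux /\ C_H1 v vx /\ C_H1 w wx /\
    forall phi, test2 phi ->
      weak_eq u v w ux vx wx phi /\
      weak_eq v u w vx ux wx phi /\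
      weak_eq w u v wx ux vx phi.

(** C^1 function on R (its restriction to R^+ is C^1(R^+)) *)
Definition C1 (b : R -> R) : Prop :=
  (forall t, derivable b t 1) /\ continuous (derive1 b).

Definition x_symmetric (u v w : R -> R -> R) : Prop :=
  exists b : R -> R, C1 b /\
    forall t, 0 <= t ->
      {ae (@lebesgue_measure R), forall x,
         u t x = u t (2 * b t - x) /\ v t x = v t (2 * b t - x) /\
         w t x = w t (2 * b t - x)}.

Definition unique_weak_solution (u v w : R -> R -> R) : Prop :=
  forall u' v' w' : R -> R -> R, weak_solution u' v' w' ->
  forall t0, 0 <= t0 ->
    {ae (@lebesgue_measure R), forall x,
       u' t0 x = u t0 x /\ v' t0 x = v t0 x /\ w' t0 x = w t0 x} ->
    forall t, 0 <= t ->
      {ae (@lebesgue_measure R), forall x,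
         u' t x = u t x /\ v' t x = v t x /\ w' t x = w t x}.

Definition traveling_wave (u v w : R -> R -> R) : Prop :=
  exists (c t0 : R) (U V W : R -> R), 0 <= t0 /\
    forall t, 0 <= t ->
      {ae (@lebesgue_measure R), forall x,
         u t x = U (x - c * (t - t0)) /\ v t x = V (x - c * (t - t0)) /\
         w t x = W (x - c * (t - t0))}.

End Defs.

(* Main.v *)
(* Let c = b'(1). Testing the weak equation with theta(t) psi(x) and reflecting
   psi about b(t) shows that, at time 1, the spatial part of the equation equals
   c times the pairing of u with (1 - d_x^2) psi'. Indeed the mass
   g_psi(t) = <u(t), (1 - d_x^2) psi> has the flux N_psi as its weak time
   derivative, N changes sign when psi is reflected about b(1) (u_x, v_x and w_x
   are odd about b(1), by uniqueness of weak derivatives), and by symmetry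
   g_psi(t) minus the mass of the reflected psi is the pairing of u(t) with the
   increment chi(2 b(t) - x) - chi(2 b(1) - x), where chi = psi - psi'', whose
   derivative at t = 1 is 2 c <u(1), chi'>.
   This identity says exactly that z(1, x - c (t - 1)) is a weak solution; it
   agrees with z at t = 1, so uniqueness concludes. *)
Require Import Defs.
From mathcomp Require Import all_boot all_order all_algebra.
From mathcomp Require Import all_classical all_reals all_analysis.
From mathcomp Require Import measurable_realfun ring lra.
Set Implicit Arguments. Unset Strict Implicit. Unset Printing Implicit Defensive.
Import Order.TTheory GRing.Theory Num.Theory.
Import numFieldNormedType.Exports.
Local Open Scope classical_set_scope.
Local Open Scope ring_scope.

(** * Integrals over the real line *)

(** The solution is only continuous in time with values in H1, so [u t (2 * b t - x)] cannot be
    differentiated in [t] directly. The motion of the axis is therefore carried by the test function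
    alone: [u t] enters the difference quotient only through its L2 limit at the base time, and the
    C1 regularity of [b] supplies the rest. It remains to compare a classical derivative at one
    point with a weak one. Both sides of the comparison are doubled, the flux because it changes
    sign under reflection, the mass because moving the axis by [k] moves reflected points by [2 k];
    the two factors cancel. The argument needs a positive base time, as test functions vanish near
    time [0]; the value 1 is one choice. The equations for [v] and [w] are that for [u] with the
    components permuted, so one identity, with one speed [c], serves all three. The travelling wave
    solves the equation because, in coordinates moving with speed [c], the time term and the flux
    combine into the time derivative of the pairing of the profile with [(1 - d_x^2) phi], whose
    integral vanishes by compact support. *)

Section RealIntegral.
Context {R : realType}.
Notation mu := (@lebesgue_measure R).
Implicit Types (f g : R -> R) (a c X : R).

Definition intg f := mu.-integrable setT (EFin \o f).

Lemma intg_meas f : intg f -> measurable_fun setT f.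
Proof. by move=> /(measurable_int mu)/measurable_EFinP. Qed.

Lemma le_intg f g : measurable_fun setT f -> (forall x, `|f x| <= g x) ->
  intg g -> intg f.
Proof.
move=> mf fg; apply: le_integrable => //; first exact/measurable_EFinP.
by move=> x _ /=; rewrite lee_fin (le_trans (fg x)) ?ler_norm.
Qed.

Lemma intgD f g : intg f -> intg g -> intg (fun x => f x + g x).
Proof. by move=> fi gi; have := integrableD measurableT fi gi; exact: eq_integrable. Qed.

Lemma intgB f g : intg f -> intg g -> intg (fun x => f x - g x).
Proof. by move=> fi gi; have := integrableB measurableT fi gi; exact: eq_integrable. Qed.

Lemma intgZl c f : intg f -> intg (fun x => c * f x).
Proof. by move=> fi; have := integrableZl measurableT c fi; exact: eq_integrable. Qed.

Lemma intg_norm f : intg f -> intg (fun x => `|f x|).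
Proof. exact: integrable_norm. Qed.

Lemma intgM f g M : intg f -> measurable_fun setT g ->
  (forall x, `|g x| <= M) -> intg (fun x => f x * g x).
Proof.
move=> fi mg gM; apply: (@le_intg _ (fun x => M * `|f x|)).
- by apply: measurable_funM => //; exact: intg_meas.
- by move=> x; rewrite normrM mulrC ler_wpM2r.
- exact/intgZl/intg_norm.
Qed.

Lemma cont_meas f : continuous f -> measurable_fun setT f.
Proof. exact: continuous_measurable_fun. Qed.

Lemma cont_cpt_intg f a c : continuous f ->
  (forall x, ~~ (a <= x <= c) -> f x = 0) -> intg f.
Proof.
move=> cf f0.
have /(integrable_mkcond _ _) : mu.-integrable `[a, c] (EFin \o f).
  apply: continuous_compact_integrable; first exact: segment_compact.
  exact: continuous_subspaceT.
move=> /(_ (measurable_itv _)); apply: eq_integrable => // x _.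
rewrite /= patchE; case: ifPn => // /negP xn; rewrite f0//.
by apply: contra_notN xn => ?; rewrite inE/= in_itv.
Qed.

Lemma cont_cpt_bounded f a c : continuous f ->
  (forall x, ~~ (a <= x <= c) -> f x = 0) ->
  exists2 M, 0 <= M & forall x, `|f x| <= M.
Proof.
move=> cf f0.
have : compact (f @` `[a, c]).
  by apply: continuous_compact; [exact: continuous_subspaceT|exact: segment_compact].
move=> /compact_bounded[M [_ MP]]; exists (`|M| + 1); first by rewrite addr_ge0.
move=> x; have [xac|/f0->] := boolP (a <= x <= c); last by rewrite normr0 addr_ge0.
by apply: (MP (`|M| + 1)); [rewrite ltr_pwDr// ler_norm|exists x => //; rewrite /= in_itv].
Qed.

Lemma RintD f g : intg f -> intg g ->
  \int[mu]_x (f x + g x) = \int[mu]_x f x + \int[mu]_x g x.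
Proof. exact: RintegralD. Qed.

Lemma RintB f g : intg f -> intg g ->
  \int[mu]_x (f x - g x) = \int[mu]_x f x - \int[mu]_x g x.
Proof. exact: RintegralB. Qed.

Lemma RintZl c f : intg f -> \int[mu]_x (c * f x) = c * \int[mu]_x f x.
Proof. exact: RintegralZl. Qed.

Lemma Rint_le f g : intg f -> intg g -> (forall x, f x <= g x) ->
  \int[mu]_x f x <= \int[mu]_x g x.
Proof. by move=> *; exact: le_Rintegral. Qed.

Lemma Rint_norm_le f g : intg f -> intg g -> (forall x, `|f x| <= g x) ->
  `|\int[mu]_x f x| <= \int[mu]_x g x.
Proof.
move=> fi gi fg; apply: le_trans (le_normr_Rintegral measurableT fi) _.
by apply: Rint_le => //; exact: intg_norm.
Qed.

Lemma Rint_eq f g : (forall x, f x = g x) -> \int[mu]_x f x = \int[mu]_x g x.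
Proof. by move=> fg; apply: eq_Rintegral => x _. Qed.

Lemma ae_mono (P Q : R -> Prop) : {ae mu, forall x, P x} ->
  (forall x, P x -> Q x) -> {ae mu, forall x, Q x}.
Proof.
move=> [A [mA A0 PA]] PQ; exists A; split => // x /= nQ; apply: PA => /= /PQ.
exact: nQ.
Qed.

Lemma ae_and (P Q : R -> Prop) : {ae mu, forall x, P x} ->
  {ae mu, forall x, Q x} -> {ae mu, forall x, P x /\ Q x}.
Proof.
move=> aP aQ; have := negligibleU aP aQ; apply: negligibleS => x /= nPQ.
by apply: contrapT => /not_orP[/contrapT ? /contrapT ?]; apply: nPQ.
Qed.

Lemma Rint_ae f g : measurable_fun setT f -> measurable_fun setT g ->
  {ae mu, forall x, f x = g x} -> \int[mu]_x f x = \int[mu]_x g x.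
Proof.
move=> mf mg fg; rewrite /Rintegral; congr fine.
apply: ae_eq_integral => //; [exact/measurable_EFinP|exact/measurable_EFinP|].
by apply: ae_mono fg _ => x -> _.
Qed.

Lemma Rint_supp f (D : set R) : measurable D -> (forall x, ~ D x -> f x = 0) ->
  \int[mu]_(x in D) f x = \int[mu]_x f x.
Proof.
move=> mD fD; rewrite Rintegral_mkcond; apply: Rint_eq => x.
by rewrite patchE; case: ifPn => // /negP xD; rewrite fD// => Dx; apply: xD; rewrite inE.
Qed.

Let refl a : measurableTypeR R -> measurableTypeR R := fun x => a - x.

Let meas_refl a : measurable_fun setT (refl a).
Proof. by apply: measurable_funB => //; exact: measurable_cst. Qed.

(** Uniqueness of Lebesgue measure: the pushforward has the right value on half-open intervals.
    Reflection exchanges the open and the closed end, which does not affect the length. *)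
Let lebesgue_push a (A : set (measurableTypeR R)) : measurable A ->
  pushforward mu (refl a) A = mu A.
Proof.
move=> mA; apply/esym.
apply: (@lebesgue_measure_unique R (pushforward mu (refl a) : {measure set _ -> \bar R})) .
all: try exact: (@meas_refl a).
all: try exact: mA.

move=> _ [[c d]] _ <-; rewrite /pushforward /=.
have E : [set x : R | c < a - x <= d] = `[a - d, a - c[%classic.
  by apply/seteqP; split => x /=; rewrite !in_itv/= => /andP[] *; apply/andP; split; lra.
transitivity (mu `[a - d, a - c[%classic).
  rewrite !lebesgue_measure_itv/= !lte_fin.
  have -> : (a - d < a - c) = (c < d) by apply/idP/idP; lra.
  by case: ifP => // _; rewrite -!EFinB; congr (_%:E); lra.
by rewrite -E; congr (mu _); apply/seteqP; split => x /=; rewrite in_itv.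
Qed.

Lemma lebesgue_refl a (A : set R) : measurable A ->
  mu [set x | A (a - x)] = mu A.
Proof. exact: lebesgue_push. Qed.

Lemma meas_comp_refl a f : measurable_fun setT f ->
  measurable_fun setT (fun x : R => f (a - x)).
Proof. by move=> mf; apply: (measurableT_comp mf); exact: meas_refl. Qed.

Lemma intg_refl a f : intg f -> intg (fun x => f (a - x)).
Proof.
move=> fi; have mf := intg_meas fi.
apply/integrableP; split.
  by apply/measurable_EFinP; have := @meas_comp_refl a f mf.
have := @ge0_integral_pushforward _ _ _ _ _ (refl a) (@meas_refl a) mu setT
  (fun x => (`|f x|)%:E) measurableT.
rewrite preimage_setT => /= <-.
- rewrite (@eq_measure_integral _ _ _ _ mu).
    by move/integrableP : fi => [].
  by move=> A mA _; exact: lebesgue_refl.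
- by apply/measurable_EFinP; exact: measurableT_comp.
- by move=> x _; rewrite lee_fin.
Qed.

Lemma Rint_refl a f : intg f -> \int[mu]_x f (a - x) = \int[mu]_x f x.
Proof.
move=> fi; rewrite /Rintegral; congr fine.
have ri : mu.-integrable (refl a @^-1` setT) ((EFin \o f) \o refl a).
  by rewrite preimage_setT; exact: (@intg_refl a f fi).
have mf : measurable_fun [set: measurableTypeR R] (EFin \o f).
  by apply/measurable_EFinP; have := intg_meas fi.
have := integral_pushforward (@meas_refl a) mf ri measurableT.
rewrite preimage_setT => /= <-.
by apply: eq_measure_integral => A mA _; exact: lebesgue_push.
Qed.

(** A translation is the composite of two reflections, so the translation lemmas all follow from the
    reflection lemmas. *)
Let shiftE a x : x - a = - a - (0 - x). Proof. by rewrite sub0r opprK addrC. Qed.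

Lemma meas_shift a f : measurable_fun setT f ->
  measurable_fun setT (fun x : R => f (x - a)).
Proof.
move=> /(meas_comp_refl (- a))/(meas_comp_refl 0).
by under eq_fun do rewrite -shiftE.
Qed.

Lemma intg_shift a f : intg f -> intg (fun x => f (x - a)).
Proof.
move=> /(intg_refl (- a))/(intg_refl 0).
by rewrite /intg; apply: eq_integrable => // x _ /=; rewrite -shiftE.
Qed.

Lemma Rint_shift a f : intg f -> \int[mu]_x f (x - a) = \int[mu]_x f x.
Proof.
move=> fi; rewrite -(@Rint_refl (- a) f)// -(@Rint_refl 0 (fun x => f (- a - x))).
  by apply: Rint_eq => x; rewrite -shiftE.
exact: intg_refl.
Qed.

End RealIntegral.

(** * Square-integrable functions and strong convergence in L2 *)

Section SquareIntegrable.
Context {R : realType}.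
Notation mu := (@lebesgue_measure R).
Implicit Types (f g h : R -> R) (a c : R).

Lemma L2_meas f : L2 f -> measurable_fun setT f.
Proof. by case. Qed.

Lemma L2_sqr f : L2 f -> intg (fun x => f x ^+ 2).
Proof. by case. Qed.

Lemma L2M_intg f g : L2 f -> L2 g -> intg (fun x => f x * g x).
Proof.
move=> [mf fi] [mg gi]; apply: (@le_intg _ _ (fun x => f x ^+ 2 + g x ^+ 2)).
- exact: measurable_funM.
- move=> x; rewrite normrM -(real_normK (num_real (f x))) -(real_normK (num_real (g x))).
  have := normr_ge0 (f x); have := normr_ge0 (g x); nra.
- exact: intgD.
Qed.

Lemma L2_le f g : measurable_fun setT f -> L2 g ->
  (forall x, `|f x| <= `|g x|) -> L2 f.
Proof.
move=> mf [mg gi] fg; split => //.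
apply: (@le_intg _ _ (fun x => g x ^+ 2)) => //; first exact: measurable_funX.
move=> x; rewrite normrX -(real_normK (num_real (g x))).
by rewrite ler_pXn2r ?nnegrE.
Qed.

Lemma L2D f g : L2 f -> L2 g -> L2 (fun x => f x + g x).
Proof.
move=> [mf fi] [mg gi]; split; first exact: measurable_funD.
apply: (@le_intg _ _ (fun x => 2 * f x ^+ 2 + 2 * g x ^+ 2)).
- by apply: measurable_funX; exact: measurable_funD.
- move=> x; rewrite ger0_norm ?sqr_ge0//; have := sqr_ge0 (f x - g x); nra.
- by apply: intgD; exact: intgZl.
Qed.

Lemma L2Zl c f : L2 f -> L2 (fun x => c * f x).
Proof.
move=> [mf fi]; split; first exact: measurable_funM.
have := intgZl (c ^+ 2) fi; rewrite /intg; apply: eq_integrable => // x _ /=.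
by rewrite exprMn.
Qed.

Lemma L2B f g : L2 f -> L2 g -> L2 (fun x => f x - g x).
Proof.
move=> fi gi; have := L2D fi (L2Zl (- 1) gi).
by under eq_fun do rewrite mulN1r.
Qed.

Lemma L2Mb f g M : L2 f -> measurable_fun setT g -> (forall x, `|g x| <= M) ->
  L2 (fun x => f x * g x).
Proof.
move=> fi mg gM; apply: (@L2_le _ (fun x => M * f x)).
- by apply: measurable_funM => //; exact: L2_meas.
- exact: L2Zl.
- move=> x; rewrite !normrM mulrC ler_wpM2r// (le_trans (gM x))//.
  exact: ler_norm.
Qed.

Lemma cont_cpt_L2 f a c : continuous f ->
  (forall x, ~~ (a <= x <= c) -> f x = 0) -> L2 f.
Proof.
move=> cf f0; split; first exact: cont_meas.
apply: (@cont_cpt_intg _ _ a c).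
  by move=> x; under eq_fun do rewrite expr2; apply: cvgM; exact: cf.
by move=> x /f0 ->; rewrite expr0n.
Qed.

Lemma L2_refl a f : L2 f -> L2 (fun x => f (a - x)).
Proof.
by move=> [mf fi]; split; [exact: meas_comp_refl|exact: (intg_refl a fi)].
Qed.

Lemma L2_shift a f : L2 f -> L2 (fun x => f (x - a)).
Proof.
by move=> [mf fi]; split; [exact: meas_shift|exact: (intg_shift a fi)].
Qed.

(** Strong L2 convergence, measured by the squared norm. Square integrability is asked only
    eventually along [F]: [u s] is known to lie in L2 for [0 <= s], whereas [F] is typically the
    full neighbourhood of a time. *)
Definition L2cvg {T : Type} (F : set_system T) (f : T -> R -> R) f0 :=
  [/\ \forall s \near F, L2 (f s), L2 f0 &
      (\int[mu]_x (f s x - f0 x) ^+ 2) @[s --> F] --> (0 : R)].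

Context {T : Type} (F : set_system T) {FF : Filter F}.

Lemma L2cvg_intro (f : T -> R -> R) f0 (b : T -> R) :
  (\forall s \near F, L2 (f s)) -> L2 f0 ->
  (\forall s \near F, \int[mu]_x (f s x - f0 x) ^+ 2 <= b s) ->
  b s @[s --> F] --> 0 -> L2cvg F f f0.
Proof.
move=> Lf Lf0 fb b0; split => //.
apply: (@squeeze_cvgr _ _ _ _ (fun _ => 0)); [|exact: cvg_cst|exact: b0].
near=> s; apply/andP; split; last by near: s.
by apply: Rintegral_ge0 => x _; exact: sqr_ge0.
Unshelve. all: by end_near. Qed.

Lemma L2cvg_cst f0 : L2 f0 -> L2cvg F (fun _ => f0) f0.
Proof.
move=> Lf0; apply: (@L2cvg_intro _ _ (fun _ => 0)) => //; last exact: cvg_cst.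
  exact: nearW.
apply: nearW => s; under eq_Rintegral do rewrite subrr expr0n/=.
by rewrite Rintegral_cst// mul0r.
Qed.

Lemma L2cvgD (f g : T -> R -> R) f0 g0 : L2cvg F f f0 -> L2cvg F g g0 ->
  L2cvg F (fun s x => f s x + g s x) (fun x => f0 x + g0 x).
Proof.
move=> [Lf Lf0 cf] [Lg Lg0 cg].
apply: (@L2cvg_intro _ _ (fun s => 2 * (\int[mu]_x (f s x - f0 x) ^+ 2) +
                                   2 * (\int[mu]_x (g s x - g0 x) ^+ 2))).
- by near=> s; apply: L2D; near: s.
- exact: L2D.
- near=> s.
  have Lfs : L2 (f s) by near: s.
  have Lgs : L2 (g s) by near: s.
  have i1 := L2_sqr (L2B Lfs Lf0); have i2 := L2_sqr (L2B Lgs Lg0).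
  rewrite -!RintZl// -RintD; [|exact: intgZl|exact: intgZl].
  apply: Rint_le; [exact: (L2_sqr (L2B (L2D Lfs Lgs) (L2D Lf0 Lg0)))| |].
    by apply: intgD; exact: intgZl.
  move=> x; have := sqr_ge0 ((f s x - f0 x) - (g s x - g0 x)); nra.
- rewrite -[X in _ --> X](addr0 0) -[X in _ --> X + _](mulr0 2) -[X in _ --> _ + X](mulr0 2).
  by apply: cvgD; apply: cvgMr.
Unshelve. all: by end_near. Qed.

Lemma L2cvgMb (f : T -> R -> R) f0 h M : L2cvg F f f0 ->
  measurable_fun setT h -> (forall x, `|h x| <= M) ->
  L2cvg F (fun s x => f s x * h x) (fun x => f0 x * h x).
Proof.
move=> [Lf Lf0 cf] mh hM.
apply: (@L2cvg_intro _ _ (fun s => M ^+ 2 * (\int[mu]_x (f s x - f0 x) ^+ 2))).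
- by near=> s; apply: L2Mb mh hM; near: s.
- exact: L2Mb mh hM.
- near=> s.
  have Lfs : L2 (f s) by near: s.
  have i1 := L2_sqr (L2B Lfs Lf0).
  rewrite -RintZl//; apply: Rint_le; [|exact: intgZl|].
    exact: (L2_sqr (L2B (L2Mb Lfs mh hM) (L2Mb Lf0 mh hM))).
  move=> x; rewrite -mulrBl exprMn mulrC ler_wpM2r ?sqr_ge0//.
  by rewrite -(real_normK (num_real (h x))) ler_pXn2r ?nnegrE// (le_trans _ (hM x)).
- by rewrite -[X in _ --> X](mulr0 (M ^+ 2)); exact: cvgMr.
Unshelve. all: by end_near. Qed.

(** With [p] and [q] the two errors, [f g - f0 g0 = p q + p g0 + q f0]. A weighted Young inequality,
    applied pointwise to the cross terms, bounds this by the squared errors plus a small multiple of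
    the fixed squares. *)
Lemma L2cvgM (f g : T -> R -> R) f0 g0 : L2cvg F f f0 -> L2cvg F g g0 ->
  (\int[mu]_x (f s x * g s x)) @[s --> F] --> \int[mu]_x (f0 x * g0 x).
Proof.
move=> [Lf Lf0 cf] [Lg Lg0 cg]; apply/cvgrPdist_lt => e e0.
pose S := \int[mu]_x (f0 x ^+ 2 + g0 x ^+ 2).
have S0 : 0 <= S by apply: Rintegral_ge0 => x _; rewrite addr_ge0 ?sqr_ge0.
(* The weight [l] makes [l / 2 * S] at most [e / 2]. The squared errors then carry the coefficient
   [K], one half from [p q] and [l^-1 / 2] from a cross term, and the tolerance [e / (4 * K)] for
   each of them accounts for the other [e / 2]. *)
pose l := e / (S + 1); have l0 : 0 < l by rewrite divr_gt0// ltr_wpDl.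
pose K := (1 + l^-1) / 2.
have K0 : 0 < K by rewrite divr_gt0// addr_gt0// invr_gt0.
have d0 : 0 < e / (4 * K) by rewrite divr_gt0// mulr_gt0.
near=> s.
have Lfs : L2 (f s) by near: s.
have Lgs : L2 (g s) by near: s.
pose p x := f s x - f0 x; pose q x := g s x - g0 x.
have ip := L2_sqr (L2B Lfs Lf0); have iq := L2_sqr (L2B Lgs Lg0).
have i0 := intgD (L2_sqr Lf0) (L2_sqr Lg0).
have Pd : \int[mu]_x ((f s x - f0 x) ^+ 2) < e / (4 * K).
  by near: s; apply: (cvgr_lt 0 cf).
have Qd : \int[mu]_x ((g s x - g0 x) ^+ 2) < e / (4 * K).
  by near: s; apply: (cvgr_lt 0 cg).
rewrite distrC -RintB; [|exact: L2M_intg|exact: L2M_intg].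
apply: (@le_lt_trans _ _ (\int[mu]_x (K * (p x ^+ 2 + q x ^+ 2) +
     l / 2 * (f0 x ^+ 2 + g0 x ^+ 2)))).
  apply: Rint_norm_le; first by apply: intgB; exact: L2M_intg.
    by apply: intgD; apply: intgZl => //; exact: intgD.
  move=> x; rewrite [X in `|X|](_ : _ = p x * q x + p x * g0 x + q x * f0 x); last first.
    by rewrite /p /q; ring.
  have H (y z : R) : `|y * z| <= (l^-1 * y ^+ 2 + l * z ^+ 2) / 2.
    have E : l^-1 * y ^+ 2 + l * z ^+ 2 = l^-1 * (y ^+ 2 + (l * z) ^+ 2).
      by field; rewrite gt_eqF.
    have -> : y * z = l^-1 * (y * (l * z)) by field; rewrite gt_eqF.
    rewrite E normrM gtr0_norm ?invr_gt0// -mulrA ler_pM2l ?invr_gt0//.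
    by rewrite ler_norml; apply/andP; split;
      [have := sqr_ge0 (y + l * z)|have := sqr_ge0 (y - l * z)]; nra.
  have H1 : `|p x * q x| <= (p x ^+ 2 + q x ^+ 2) / 2.
    by rewrite ler_norml; apply/andP; split;
      [have := sqr_ge0 (p x + q x)|have := sqr_ge0 (p x - q x)]; nra.
  have := H (p x) (g0 x); have := H (q x) (f0 x); have := H1.
  have := ler_normD (p x * q x + p x * g0 x) (q x * f0 x).
  have := ler_normD (p x * q x) (p x * g0 x).
  rewrite /K; nra.
rewrite RintD; last 2 first.
- by apply: intgZl; exact: intgD.
- exact: intgZl.
rewrite !RintZl//; last exact: intgD.
rewrite RintD// -/S.
have -> : e = K * (e / (4 * K) + e / (4 * K)) + e / 2.
  by field; rewrite gt_eqF.
apply: ltr_leD; first by rewrite ltr_pM2l// ltrD.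
have : l * (S + 1) = e by rewrite /l divfK// gt_eqF// ltr_wpDl.
nra.
Unshelve. all: by end_near. Qed.

End SquareIntegrable.

(** For [0 < t] all times close to [t] are nonnegative, so continuity on nonnegative times becomes
    convergence along the full neighbourhood filter. [H1dist2] dominates the squared L2 distance of
    either component. *)
Lemma C_H1_L2cvg (R : realType) (u ux : R -> R -> R) (t : R) : C_H1 u ux -> 0 < t ->
  L2cvg (nbhs t) u (u t) /\ L2cvg (nbhs t) ux (ux t).
Proof.
move=> [H cH] t0.
have HL s : 0 <= s -> L2 (u s) /\ L2 (ux s) by move=> /H[? []].
have [Lu Lux] := HL t (ltW t0).
have nL : \forall s \near t, 0 <= s.
  by near=> s; apply: ltW; near: s; exact: (cvgr_gt t (@cvg_id _ (nbhs t))).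
have Hd : (H1dist2 (u s) (ux s) (u t) (ux t)) @[s --> t] --> (0 : R).
  apply/cvgrPdist_lt => e e0; have [d [d0 dP]] := cH t (ltW t0) e e0.
  near=> s; rewrite sub0r normrN ger0_norm; last first.
    by apply: Rintegral_ge0 => x _; rewrite addr_ge0 ?sqr_ge0.
  apply: dP; first by near: s.
  by rewrite distrC; near: s; move/cvgrPdist_lt: (@cvg_id _ (nbhs t)); apply.
have Hi s : 0 <= s -> intg (fun x => (u s x - u t x) ^+ 2) /\
                      intg (fun x => (ux s x - ux t x) ^+ 2).
  by move=> /HL[? ?]; split; apply: L2_sqr; exact: L2B.
split.
- apply: (@L2cvg_intro _ _ _ _ _ _ (fun s => H1dist2 (u s) (ux s) (u t) (ux t))) => //.
    by near=> s; apply: (HL s _).1; near: s.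
  near=> s; have [|i1 i2] := Hi s; first by near: s.
  apply: Rint_le => //; first exact: intgD.
  by move=> x; rewrite lerDl sqr_ge0.
- apply: (@L2cvg_intro _ _ _ _ _ _ (fun s => H1dist2 (u s) (ux s) (u t) (ux t))) => //.
    by near=> s; apply: (HL s _).2; near: s.
  near=> s; have [|i1 i2] := Hi s; first by near: s.
  apply: Rint_le => //; first exact: intgD.
  by move=> x; rewrite lerDr sqr_ge0.
Unshelve. all: by end_near. Qed.

(** * Smooth functions and bumps *)

Section Smooth.
Context {R : realType}.
Implicit Types (f g : R -> R) (a c s x : R) (n k : nat).

Definition has_deriv f (df : R -> R) := forall x, is_derive x 1 (f : R -> R^o) (df x).

Lemma has_deriv_derive1 f df : has_deriv f df -> derive1 (f : R -> R^o) = df.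
Proof. by move=> H; apply/funext => x; rewrite derive1E; have [_ ->] := H x. Qed.

Lemma derivable_has_deriv f : (forall x, derivable (f : R -> R^o) x 1) ->
  has_deriv f (derive1 (f : R -> R^o)).
Proof. by move=> df x; rewrite derive1E; apply/derivableP/df. Qed.

Lemma has_deriv_continuous f df : has_deriv f df -> continuous f.
Proof.
move=> H x; apply: (@differentiable_continuous _ R^o R^o); apply/derivable1_diffP.
by have [] := H x.
Qed.

Lemma has_derivD f df g dg : has_deriv f df -> has_deriv g dg ->
  has_deriv (fun x => f x + g x) (fun x => df x + dg x).
Proof. by move=> Hf Hg x; apply: is_deriveD. Qed.

Lemma has_derivM f df g dg : has_deriv f df -> has_deriv g dg ->
  has_deriv (fun x => f x * g x) (fun x => df x * g x + f x * dg x).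
Proof.
move=> Hf Hg x; have H := @is_deriveM _ _ _ _ x 1 _ _ (Hf x) (Hg x).
by apply: is_derive_eq H _; rewrite /GRing.scale/=; ring.
Qed.

Lemma has_derivZ c f df : has_deriv f df -> has_deriv (fun x => c * f x) (fun x => c * df x).
Proof. by move=> Hf x; apply: (@is_deriveZ _ _ _ (f : R -> R^o)). Qed.

Lemma has_derivB f df g dg : has_deriv f df -> has_deriv g dg ->
  has_deriv (fun x => f x - g x) (fun x => df x - dg x).
Proof. by move=> Hf Hg x; apply: is_deriveB. Qed.

Lemma has_deriv_aff a c f df : has_deriv f df ->
  has_deriv (fun x => f (a * x + c)) (fun x => a * df (a * x + c)).
Proof.
move=> Hf x.
have Hg : is_derive x 1 ((fun x => a * x + c) : R -> R^o) a.
  have := @is_deriveD _ R^o R^o _ _ x 1 _ _ (@is_deriveZ _ _ R^o (id : R -> R^o) a x 1 1 (is_derive_id _ _)) (is_derive_cst c x 1).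
  by move=> H; apply: is_derive_eq H _; rewrite addr0 /GRing.scale/= mulr1.
have H := @is_derive1_comp _ (f : R -> R^o) (fun x => a * x + c) x _ _ (Hf _) Hg.
by apply: is_derive_eq H _; rewrite /GRing.scale/= mulrC.
Qed.

Lemma has_deriv_shift c f df : has_deriv f df -> has_deriv (fun x => f (x + c)) (fun x => df (x + c)).
Proof.
move=> /(has_deriv_aff 1 c) H x; have := H x; rewrite !mul1r.
by under eq_fun do rewrite mul1r.
Qed.

Lemma has_deriv_refl c f df : has_deriv f df ->
  has_deriv (fun x => f (c - x)) (fun x => - df (c - x)).
Proof.
move=> /(has_deriv_aff (-1) c) H x; have := H x; rewrite !mulN1r addrC.
by under eq_fun do rewrite mulN1r addrC.
Qed.

Lemma derive1_local0 f x : (\forall y \near x, f y = 0) ->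
  derive1 (f : R -> R^o) x = 0.
Proof.
move=> f0; rewrite derive1E -(derive_cst (0 : R^o) x 1).
exact: near_eq_derive.
Qed.

Lemma derive1_supp f a c : (forall x, ~~ (a <= x <= c) -> f x = 0) ->
  forall x, ~~ (a <= x <= c) -> derive1 (f : R -> R^o) x = 0.
Proof.
move=> f0 t tr; apply: derive1_local0.
have : \forall y \near t, ~~ (a <= y <= c).
  move: tr; rewrite negb_and -!ltNge => /orP[] H.
    have : \forall y \near t, y < a by exact: (cvgr_lt t (@cvg_id _ (nbhs t))).
    by apply: filterS => y ya; rewrite negb_and -!ltNge ya.
  have : \forall y \near t, c < y by exact: (cvgr_gt t (@cvg_id _ (nbhs t))).
  by apply: filterS => y ya; rewrite negb_and -!ltNge ya orbT.
by apply: filterS => y /f0.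
Qed.

(** Unlike [iter n], which differentiates on the outside, this recursion strips the derivative next
    to [f]. The rules for sums, products and affine changes of variable then follow by induction
    with [f] general. *)
Fixpoint nderiv n f : Prop :=
  if n is n'.+1 then (forall x, derivable (f : R -> R^o) x 1) /\ nderiv n' (derive1 (f : R -> R^o))
  else True.

Lemma smooth1P f : smooth1 f <-> forall n, nderiv n f.
Proof.
split.
  move=> sf n; elim: n f sf => //= n IH f sf; split; first exact: (sf 0%N).
  by apply: IH => k x; rewrite -iterSr; exact: sf.
move=> H n; elim: n f H => [|n IH] f H x; first by have [] := H 1%N.
by rewrite iterSr; apply: IH => k; have [] := H k.+1.
Qed.

Lemma nderivS n f : nderiv n.+1 f -> nderiv n f.
Proof. by elim: n f => // n IH f [df /IH]. Qed.

Lemma nderiv_has_deriv n f df : has_deriv f df -> nderiv n df -> nderiv n.+1 f.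
Proof.
move=> H ndf; split; first by move=> x; have [] := H x.
by rewrite (has_deriv_derive1 H).
Qed.

Lemma nderivD n f g : nderiv n f -> nderiv n g -> nderiv n (fun x => f x + g x).
Proof.
elim: n f g => // n IH f g [/derivable_has_deriv df nf] [/derivable_has_deriv dg ng].
by apply: nderiv_has_deriv (has_derivD df dg) _; exact: IH.
Qed.

Lemma nderivZ n c f : nderiv n f -> nderiv n (fun x => c * f x).
Proof.
elim: n f => // n IH f [/derivable_has_deriv df nf].
by apply: nderiv_has_deriv (has_derivZ c df) _; exact: IH.
Qed.

Lemma nderivM n f g : nderiv n f -> nderiv n g -> nderiv n (fun x => f x * g x).
Proof.
elim: n f g => // n IH f g nf ng.
have [/derivable_has_deriv df ndf] := nf; have [/derivable_has_deriv dg ndg] := ng.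
by apply: nderiv_has_deriv (has_derivM df dg) _; apply: nderivD; apply: IH => //; exact: nderivS.
Qed.

Lemma nderiv_aff n a c f : nderiv n f -> nderiv n (fun x => f (a * x + c)).
Proof.
elim: n f => // n IH f [/derivable_has_deriv df nf].
by apply: nderiv_has_deriv (has_deriv_aff a c df) _; apply: nderivZ; exact: IH.
Qed.

Lemma smooth1_has_deriv f : smooth1 f -> has_deriv f (derive1 (f : R -> R^o)).
Proof. by move=> sf; apply: derivable_has_deriv; exact: (sf 0%N). Qed.

Lemma smooth1_derive1 f : smooth1 f -> smooth1 (derive1 (f : R -> R^o)).
Proof. by move=> sf n x; rewrite -iterSr; exact: sf. Qed.

Lemma smooth1_cont f : smooth1 f -> continuous f.
Proof. by move=> /smooth1_has_deriv/has_deriv_continuous. Qed.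

Lemma test1_derive1 f : test1 f -> test1 (derive1 (f : R -> R^o)).
Proof.
move=> [sf [X fX]]; split; first exact: smooth1_derive1.
exists X => x Xx; apply: derive1_local0.
have : \forall y \near x, X < `|y|.
  exact: (cvgr_gt `|x| (cvg_norm (@cvg_id _ (nbhs x)))).
by apply: filterS => y; exact: fX.
Qed.

Lemma smooth1D f g : smooth1 f -> smooth1 g -> smooth1 (fun x => f x + g x).
Proof.
by move=> /smooth1P Hf /smooth1P Hg; apply/smooth1P => n; exact: nderivD.
Qed.

Lemma smooth1Z c f : smooth1 f -> smooth1 (fun x => c * f x).
Proof. by move=> /smooth1P Hf; apply/smooth1P => n; exact: nderivZ. Qed.

Lemma smooth1M f g : smooth1 f -> smooth1 g -> smooth1 (fun x => f x * g x).
Proof.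
by move=> /smooth1P Hf /smooth1P Hg; apply/smooth1P => n; exact: nderivM.
Qed.

Lemma smooth1_aff a c f : smooth1 f -> smooth1 (fun x => f (a * x + c)).
Proof. by move=> /smooth1P Hf; apply/smooth1P => n; exact: nderiv_aff. Qed.

Lemma smooth1_refl c f : smooth1 f -> smooth1 (fun x => f (c - x)).
Proof.
by move=> /(@smooth1_aff (-1) c _); under eq_fun do rewrite mulN1r addrC.
Qed.

Lemma test1_refl c f : test1 f -> test1 (fun x => f (c - x)).
Proof.
move=> [sf [X fX]]; split; first exact: smooth1_refl.
exists (X + `|c|) => x Xx; apply: fX; have := ler_normB c (c - x).
by rewrite opprB addrC subrK; lra.
Qed.

Lemma test1_supp f : test1 f -> exists X, forall x, ~~ (- X <= x <= X) -> f x = 0.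
Proof.
move=> [_ [X fX]]; exists X => x xX; apply: fX.
by rewrite ltNge; apply: contra xX; rewrite ler_norml.
Qed.

Lemma test1_cont f : test1 f -> continuous f.
Proof. by case=> /smooth1_cont. Qed.

Lemma test1_meas f : test1 f -> measurable_fun setT f.
Proof. by move=> /test1_cont/cont_meas. Qed.

Lemma test1_intg f : test1 f -> intg f.
Proof.
by move=> tf; have [X fX] := test1_supp tf; apply: (cont_cpt_intg _ fX); exact: test1_cont.
Qed.

Lemma test1_L2 f : test1 f -> L2 f.
Proof.
by move=> tf; have [X fX] := test1_supp tf; apply: (cont_cpt_L2 _ fX); exact: test1_cont.
Qed.

Lemma test1_bounded f : test1 f -> exists2 M, 0 <= M & forall x, `|f x| <= M.
Proof.
move=> tf; have [X fX] := test1_supp tf.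
by apply: (cont_cpt_bounded _ fX); exact: test1_cont.
Qed.

(* Up to the factor [x ^- k], the function [exp (- 1 / x)] extended by [0] to
   [x <= 0]; this family is stable under differentiation. *)
Definition flat k x := if 0 < x then x ^- k * expR (- x^-1) else 0.

(** The series bound [1 + y^(k+1) / (k+1)! <= expR y] at [y = x^-1]. This linear decay is what gives
    the derivative of [flat] at [0]. *)
Lemma flat_le k x : `|flat k x| <= k.+1`!%:R * `|x|.
Proof.
rewrite /flat; case: ifPn => [x0|]; last by rewrite normr0 mulr_ge0.
rewrite !gtr0_norm ?mulr_gt0 ?expR_gt0 ?invr_gt0 ?exprn_gt0//.
have y0 : 0 <= x^-1 by rewrite invr_ge0 ltW.
have := expR_ge1Dxn k y0; rewrite expRN exprVn => H.
have F0 : (0 : R) < k.+1`!%:R by rewrite ltr0n fact_gt0.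
have E0 := expR_gt0 x^-1.
rewrite ler_pdivrMr//.
have H2 : x ^- k.+1 / k.+1`!%:R <= expR x^-1 by lra.
rewrite ler_pdivrMr// in H2.
have -> : x ^- k = x * x ^- k.+1.
  by rewrite exprS invfM mulrA mulfV ?gt_eqF// mul1r.
apply: le_trans (ler_wpM2l (ltW x0) H2) _.
by rewrite le_eqVlt; apply/orP; left; apply/eqP; ring.
Qed.

Lemma flat_has_deriv k : has_deriv (flat k) (fun x => - k%:R * flat k.+1 x + flat k.+2 x).
Proof.
move=> x; have [x0|x0|<-] := ltgtP 0 x.
- have nE : \forall y \near x, (fun y => y ^- k * expR (- y^-1)) y = flat k y.
    near=> y; rewrite /flat ifT//; near: y.
    exact: (cvgr_gt x (@cvg_id _ (nbhs x))).
  apply: (near_eq_is_derive nE).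
  have xn : x != 0 by rewrite gt_eqF.
  have dV : is_derive x 1 (fun y : R => y^-1 : R^o) (- x ^- 2).
    have H := @is_deriveV R (id : R -> R) x 1 1 xn (is_derive_id _ _).
    by apply: is_derive_eq H _; rewrite /GRing.scale/= mulr1.
  have dE : is_derive x 1 (fun y : R => expR (- y^-1) : R^o) (x ^- 2 * expR (- x^-1)).
    have H := @is_derive1_comp _ (expR : R -> R^o) (fun y => - y^-1) x _ _
      (is_derive_expR _) (is_deriveN dV).
    by apply: is_derive_eq H _; rewrite opprK /GRing.scale/= mulrC.
  have dP : is_derive x 1 (fun y : R => y ^- k : R^o) (- k%:R * x ^- k.+1).
    have H := @is_deriveX R R^o (fun y : R => y^-1) k x 1 _ dV.
    have -> : (fun y : R => y ^- k) = (fun y => y^-1) ^+ k.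
      by apply/funext => y; rewrite fctE exprVn.
    apply: is_derive_eq H _; rewrite /GRing.scale/=.
    case: k {nE} => [|k]; first by rewrite !mul0r oppr0 mul0r.
    rewrite -[x^-1 ^+ _]/(x^-1 ^+ k) mulrN mulNr -mulrA; congr (- (_ * _)).
    by rewrite -!exprVn -exprD addn2.
  have H := @is_deriveM _ _ _ _ x 1 _ _ dP dE.
  apply: is_derive_eq H _; rewrite /flat x0 /GRing.scale/=.
  rewrite -!exprVn addrC [in RHS]mulrA; congr (_ + _); first by rewrite mulrC.
  by rewrite mulrA -exprD addn2.
- have nE : \forall y \near x, (fun=> 0) y = flat k y.
    near=> y; rewrite /flat ifN// -leNgt ltW//; near: y.
    exact: (cvgr_lt x (@cvg_id _ (nbhs x))).
  apply: (near_eq_is_derive nE).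
  have H := is_derive_cst (0 : R^o) x (1 : R).
  by apply: is_derive_eq H _; rewrite /flat !ifN -?leNgt ?ltW// mulr0 add0r.
- have f0 j : flat j 0 = 0 by rewrite /flat ltxx.
  have N0 : k.+2`!%:R * `|h| @[h --> (0 : R)^'] --> (0 : R).
    have H0 : k.+2`!%:R * `|h| @[h --> (0 : R)] --> k.+2`!%:R * `|0 : R|.
      by apply: cvgMr; apply: cvg_norm; exact: cvg_id.
    by rewrite normr0 mulr0 in H0; exact: cvg_within_filter H0.
  have H : h^-1 *: ((flat k (h *: (1 : R) + 0) : R^o) - flat k 0) @[h --> (0 : R)^'] --> (0 : R^o).
    rewrite f0; apply: (@squeeze_cvgr _ _ _ _ (fun h : R => - (k.+2`!%:R * `|h|))
      (fun h : R => k.+2`!%:R * `|h|)).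
    + near=> h; rewrite addr0 subr0 /GRing.scale/= mulr1 -ler_norml.
      have hn : h != 0 by near: h; exact: nbhs_dnbhs_neq.
      (* At the origin the difference quotient is the next member of the family, which the linear
         bound sends to [0]. *)
      suff -> : h^-1 * flat k h = flat k.+1 h by exact: flat_le.
      by rewrite /flat; case: ifP => _; rewrite ?mulr0// exprS invfM mulrA.
    + by rewrite -[X in _ --> X]oppr0; apply: cvgN.
    + exact: N0.
  rewrite !f0 mulr0 add0r; split.
    by apply/cvg_ex; exists 0.
  exact: cvg_lim H.
Unshelve. all: by end_near. Qed.

Lemma flat_smooth k : smooth1 (flat k).
Proof.
apply/smooth1P => n; elim: n k => // n IH k.
by apply: nderiv_has_deriv (@flat_has_deriv k) _; apply: nderivD => //; exact: nderivZ.
Qed.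

(* Tends to the indicator function of the interval from [a] to [c] as [s] tends
   to infinity. *)
Definition bump s a c x := flat 0 (s * (x - a)) * flat 0 (s * (c - x)).

Lemma bump_smooth s a c : smooth1 (bump s a c).
Proof.
apply: smooth1M.
  have := @smooth1_aff s (- (s * a)) _ (@flat_smooth 0).
  by under eq_fun do rewrite -mulrBr.
have := @smooth1_aff (- s) (s * c) _ (@flat_smooth 0).
by under eq_fun do rewrite mulNr addrC -mulrBr.
Qed.

Lemma flat0_bnd x : 0 <= flat 0 x <= 1.
Proof.
rewrite /flat; case: ifPn => [x0|]; last by rewrite lexx ler01.
by rewrite expr0 invr1 mul1r expR_ge0 expR_le1 oppr_le0 invr_ge0 ltW.
Qed.

Lemma bump_bnd s a c x : 0 <= bump s a c x <= 1.
Proof.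
rewrite /bump; have /andP[? ?] := flat0_bnd (s * (x - a)).
by have /andP[? ?] := flat0_bnd (s * (c - x)); rewrite mulr_ge0//= mulr_ile1.
Qed.

Lemma bump_out s a c x : 0 < s -> ~~ (a < x < c) -> bump s a c x = 0.
Proof.
move=> s0; rewrite negb_and -!leNgt /bump /flat => /orP[] H.
  by rewrite ifN ?mul0r// -leNgt pmulr_rle0// subr_le0.
by rewrite mulrC ifN ?mul0r// -leNgt pmulr_rle0// subr_le0.
Qed.

Lemma bump_test s a c : 0 < s -> test1 (bump s a c).
Proof.
move=> s0; split; first exact: bump_smooth.
exists (`|a| + `|c|) => x H; apply: bump_out => //; apply/negP => /andP[ax xc].
suff : `|x| <= `|a| + `|c| by lra.
rewrite ler_norml; have := ler_norm c; have := lerNnormlW (lexx `|a|).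
have := normr_ge0 a; have := normr_ge0 c; lra.
Qed.

End Smooth.

(** * Uniqueness of weak derivatives *)

Section FundamentalLemma.
Context {R : realType}.
Notation mu := (@lebesgue_measure R).
Implicit Types (f g h : R -> R) (a c : R) (D : set R).

Lemma Rint_dct (f_ : nat -> R -> R) f g :
  (forall n, measurable_fun setT (f_ n)) ->
  (forall x, f_ n x @[n --> \oo] --> f x) -> intg g ->
  (forall n x, `|f_ n x| <= g x) ->
  (\int[mu]_x f_ n x) @[n --> \oo] --> \int[mu]_x f x.
Proof.
move=> mf_ f_f ig fg.
have mf : measurable_fun setT f by apply: (measurable_fun_cvg mf_) => x _; exact: f_f.
have fi : intg f.
  apply: le_intg mf _ ig => x; rewrite leNgt; apply/negP => H.
  have : \forall n \near \oo, g x < `|f_ n x|.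
    by apply: (cvgr_gt `|f x|) => //; apply: cvg_norm; exact: f_f.
  by move=> /filter_ex[n]; rewrite ltNge fg.
rewrite /Rintegral; apply: fine_cvg; rewrite fineK; last exact: integrable_fin_num.
apply: (@dominated_cvg _ (measurableTypeR R) R mu setT measurableT (fun n x => (f_ n x)%:E) (EFin \o f) (EFin \o g)) => //.
- by move=> n; apply/measurable_EFinP; have := mf_ n.
- by move=> x _; apply: cvg_EFin; [exact: nearW|exact: f_f].
- by move=> n x _; rewrite lee_fin.
Qed.

Lemma intg_restrict D f : measurable D ->
  mu.-integrable D (EFin \o f) <-> intg (f \_ D).
Proof.
move=> mD; have := @integrable_mkcond _ (measurableTypeR R) R mu D (EFin \o f) mD.
by rewrite restrict_EFin.
Qed.

Lemma indic_intg D : measurable D -> (mu D < +oo)%E -> intg (\1_D : R -> R).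
Proof.
move=> mD Dfin.
have : mu.-integrable D (EFin \o (cst 1 : R -> R)).
  apply: measurable_bounded_integrable => //.
  by exists 1; split => // y y1 x _ /=; rewrite normr1 ltW.
move=> /(intg_restrict _ mD); apply: eq_integrable => // x _.
by rewrite /= patchE indicE; case: ifP.
Qed.

Lemma indic_L2 D : measurable D -> (mu D < +oo)%E -> L2 (\1_D : R -> R).
Proof.
move=> mD Dfin; split; first exact: measurable_indic.
have := indic_intg mD Dfin; apply: eq_integrable => // x _.
by rewrite /= indicE; case: (x \in D); rewrite ?expr1n ?expr0n.
Qed.

Lemma L2_integrableS h D : L2 h -> measurable D -> (mu D < +oo)%E ->
  mu.-integrable D (EFin \o h).
Proof.
move=> Lh mD Dfin; apply/(intg_restrict _ mD).
have := L2M_intg Lh (indic_L2 mD Dfin); apply: eq_integrable => // x _.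
by rewrite /= patchE indicE; case: (x \in D); rewrite ?mulr1 ?mulr0.
Qed.

Lemma itv_fin (b1 b2 : bool) a c :
  (mu [set` Interval (BSide b1 a) (BSide b2 c)] < +oo)%E.
Proof.
by rewrite lebesgue_measure_itv/=; case: ifP => // _; rewrite -?EFinB ltry.
Qed.

Lemma flat0_ge (x : R) : 0 < x -> 1 - x^-1 <= flat 0 x.
Proof.
by move=> x0; rewrite /flat x0 expr0 invr1 mul1r; exact: expR_ge1Dx.
Qed.

Lemma flat0_cvg1 (x : R) : 0 < x -> flat 0 (n.+1%:R * x) @[n --> \oo] --> (1 : R).
Proof.
move=> x0.
apply: (@squeeze_cvgr _ _ _ _ (fun n : nat => 1 - x^-1 * n.+1%:R^-1) (fun=> 1)).
- near=> n; apply/andP; split; last by have /andP[] := flat0_bnd (n.+1%:R * x).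
  have /flat0_ge : 0 < n.+1%:R * x by rewrite mulr_gt0// ltr0n.
  by rewrite invfM mulrC.
- rewrite -[X in _ --> X]subr0 -[X in _ --> _ - X](mulr0 x^-1).
  apply: cvgB; first exact: cvg_cst.
  by apply: cvgMr; exact: cvg_harmonic.
- exact: cvg_cst.
Unshelve. all: by end_near. Qed.

Lemma bump_cvg a c (x : R) :
  bump n.+1%:R a c x @[n --> \oo] --> (\1_(`]a, c[%classic : set R) x : R).
Proof.
rewrite indicE; have [xac|xac] := boolP (a < x < c).
  rewrite mem_set/= ?in_itv//= -[X in _ --> X](mul1r 1).
  have /andP[ax xc] := xac.
  by apply: cvgM; apply: flat0_cvg1; rewrite subr_gt0.
rewrite memNset/=; last by rewrite in_itv/=; exact/negP.
by under eq_fun do rewrite bump_out ?ltr0n//; exact: cvg_cst.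
Qed.

(** The bumps are test functions lying below the indicator of the open interval and converging to
    it, so dominated convergence carries the vanishing over. The half-open interval, which differs
    by a null set, is the form used for differentiating the primitive of [h]. *)
Lemma int_itv_eq0 h a c : L2 h ->
  (forall phi, test1 phi -> \int[mu]_x (h x * phi x) = 0) ->
  \int[mu]_(x in `]a, c]) h x = 0.
Proof.
move=> Lh H; have mh := L2_meas Lh.
have fin b1 b2 : (mu [set` Interval (BSide b1 a) (BSide b2 c)] < +oo)%E by exact: itv_fin.
rewrite -Rintegral_itv_bndo_bndc; last exact: L2_integrableS.
have /cvg_lim <- // : (fun n : nat => (0 : R)) @ \oo --> \int[mu]_(x in `]a, c[) h x.
  rewrite Rintegral_mkcond.
  have -> : (fun n : nat => 0 : R) = (fun n => \int[mu]_x (h x * bump n.+1%:R a c x)).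
    by apply/funext => n; rewrite H//; apply: bump_test; rewrite ltr0n.
  apply: (@Rint_dct _ _ (fun x => `|h x| * \1_(`]a, c[%classic : set R) x)).
  - move=> n; apply: measurable_funM => //; apply: test1_meas.
    by apply: bump_test; rewrite ltr0n.
  - move=> x; rewrite patchE.
    have -> : (if x \in (`]a, c[%classic : set R) then h x else 0) = h x * \1_(`]a, c[%classic : set R) x.
      by rewrite indicE; case: ifP => _; rewrite ?mulr1 ?mulr0.
    by apply: cvgMr; exact: bump_cvg.
  - have := intg_norm (L2M_intg Lh (indic_L2 (measurable_itv _) (fin false true))).
    apply: eq_integrable => // x _; rewrite /= normrM; congr (_ * _)%:E.
    by rewrite ger0_norm.
  - move=> n x; rewrite normrM ler_wpM2l// indicE.
    have /andP[b0 b1] := bump_bnd n.+1%:R a c x.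
    rewrite ger0_norm//; have [xac|xac] := boolP (a < x < c).
      by rewrite mem_set//= in_itv.
    by rewrite bump_out// ltr0n.
by rewrite lim_cst.
Qed.

Lemma L2_locally h : L2 h -> locally_integrable setT h.
Proof.
move=> Lh; split; [exact: L2_meas|exact: openT|move=> K _ cK].
have := @L2_integrableS h K Lh (compact_measurable cK) (compact_finite_measure cK).
by move=> /integrableP[].
Qed.

(** For each [N] the primitive of [h] started at [- N] is identically zero, and by Lebesgue
    differentiation its derivative is [h] almost everywhere to the right of [- N]. The countably
    many exceptional sets are then united. *)
Lemma fundamental_lemma h : L2 h ->
  (forall phi, test1 phi -> \int[mu]_x (h x * phi x) = 0) ->
  {ae mu, forall x, h x = 0}.
Proof.
move=> Lh H.
have HN (N : nat) : {ae mu, forall x, - N%:R < x -> h x = 0}.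
  have intf y : mu.-integrable [set` Interval (BRight (- N%:R : R)) (BRight y)] (EFin \o h).
    by apply: L2_integrableS => //; exact: itv_fin.
  apply: ae_mono (FTC1 intf (L2_locally Lh)) _ => x Hx Nx.
  have Nx' : (BRight (- N%:R : R) < BRight x)%O by rewrite bnd_simp.
  have [_ <-] := Hx Nx'.
  rewrite (_ : (fun _ => _) = cst 0) ?derive1_cst//.
  by apply/funext => y; exact: int_itv_eq0.
have := negligible_bigcup HN; apply: negligibleS => x /= hx.
exists (Num.truncn `|x|).+1 => //= Hx; apply: hx; apply: Hx.
have := truncnS_gt `|x|; have := lerNnormlW (lexx `|x|); lra.
Qed.

Lemma weak_deriv_unique f g1 g2 : weak_deriv f g1 -> weak_deriv f g2 ->
  L2 g1 -> L2 g2 -> {ae mu, forall x, g1 x = g2 x}.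
Proof.
move=> H1 H2 L1 L2'; have := @fundamental_lemma (fun x => g1 x - g2 x) (L2B L1 L2').
move=> /(_ _)/ae_mono; apply; last by move=> x /eqP; rewrite subr_eq0 => /eqP.
move=> phi tphi; have Lp := test1_L2 tphi.
under eq_Rintegral do rewrite mulrBl.
rewrite RintB; [|exact: L2M_intg|exact: L2M_intg].
by apply/eqP; rewrite subr_eq0 -eqr_opp -H1// -H2.
Qed.

Lemma weak_deriv_refl f g a : L2 f -> L2 g -> weak_deriv f g ->
  weak_deriv (fun x => f (a - x)) (fun x => - g (a - x)).
Proof.
move=> Lf Lg H phi tphi.
have tr := test1_refl a tphi.
have dr : derive1 ((fun x => phi (a - x)) : R -> R^o) = fun x => - derive1 (phi : R -> R^o) (a - x).
  exact: (has_deriv_derive1 (has_deriv_refl _ (smooth1_has_deriv tphi.1))).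
have := H _ tr; rewrite dr => E.
have Ld := test1_L2 (test1_derive1 tphi); have Lp := test1_L2 tphi.
rewrite -(@Rint_refl _ a) /=; last by apply: L2M_intg => //; exact: L2_refl.
under eq_Rintegral do rewrite subKr.
rewrite -[RHS](congr1 (-%R) (@Rint_refl _ a _ _))/=; last first.
  apply: L2M_intg => //; have := L2Zl (-1) (L2_refl a Lg).
  by under eq_fun do rewrite mulN1r.
under [X in _ = - X]eq_Rintegral do rewrite subKr mulNr -mulN1r.
rewrite RintZl; last by apply: L2M_intg => //; exact: L2_refl.
move: E; under eq_Rintegral do rewrite mulrN -mulN1r.
rewrite RintZl; last by apply: L2M_intg => //; exact: L2_refl.
by rewrite !mulN1r => /eqP; rewrite eqr_oppLR opprK => /eqP ->.
Qed.

End FundamentalLemma.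

(** * Continuity of translations in L2 *)

Section TranslationContinuity.
Context {R : realType}.
Notation mu := (@lebesgue_measure R).
Implicit Types (f g : R -> R) (a c M : R).

Lemma near0_norm (e : R) : 0 < e -> \forall h \near (0 : R), `|h| < e.
Proof. by move=> e0; exists e => //= h; rewrite /ball/= sub0r normrN. Qed.

(** Continuity under the integral sign at [h = 0], where the integrand is zero. For [|h| < 1] the
    shifted points stay in the interval enlarged by 1, and twice a bound of [|phi|] there
    dominates. *)
Lemma cont_shift_int (phi : R -> R) (N : R) : continuous phi ->
  (\int[mu]_(x in `[- N, N]) `|phi (x - h) - phi x|) @[h --> (0 : R)] --> (0 : R).
Proof.
move=> cphi; pose A : set R := `[- N, N]%classic.
have mA : measurable A by exact: measurable_itv.
have cshift h : continuous (fun x => phi (x - h)).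
  by move=> x; apply: continuous_comp; [apply: cvgB; [exact: cvg_id|exact: cvg_cst]|exact: cphi].
have cn h : continuous (fun x => `|phi (x - h) - phi x|).
  by move=> x; apply: cvg_norm; apply: cvgB; [exact: cshift|exact: cphi].
have int_f h : mu.-integrable A (EFin \o (fun x => `|phi (x - h) - phi x|)).
  apply: continuous_compact_integrable; first exact: segment_compact.
  exact: continuous_subspaceT.
have [M [_ MP]] : bounded_set (phi @` `[- N - 1, N + 1]%classic).
  apply/compact_bounded/continuous_compact; last exact: segment_compact.
  exact: continuous_subspaceT.
have MB x : - N - 1 <= x <= N + 1 -> `|phi x| <= `|M| + 1.
  move=> xN; apply: (MP (`|M| + 1)); first by rewrite ltr_pwDr// ler_norm.
  by exists x => //; rewrite /= in_itv.
have H := @continuity_under_integral R _ _ mu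
   (fun h x => `|phi (x - h) - phi x|) A (measurable_itv _) (-1) 1
   (fun h _ => int_f h) _ (fun _ => 2 * (`|M| + 1)) _ _ 0.
have E0 : \int[mu]_(x in A) `|phi (x - 0) - phi x| = 0.
  under eq_Rintegral do rewrite subr0 subrr normr0.
  by rewrite Rintegral_cst// mul0r.
rewrite -[X in _ --> X]E0; apply: H.

- apply: aeW => y _ h _; apply: cvg_norm; apply: cvgB; last exact: cvg_cst.
  apply: continuous_comp; last exact: cphi.
  by apply: cvgB; [exact: cvg_cst|exact: cvg_id].
- apply: continuous_compact_integrable; first exact: segment_compact.
  by apply: continuous_subspaceT => ?; exact: cvg_cst.
- move=> h; rewrite /= in_itv/= => /andP[h1 h2].
  apply: aeW => y; rewrite /A/= in_itv/= => /andP[y1 y2].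
  rewrite normr_id (le_trans (ler_normB _ _))// mulr_natl mulr2n lerD// MB//; lra.
- by rewrite inE/= in_itv/= ltrN10 ltr01.
Qed.

(** Boundedness trades L2 for L1: one factor of the square is at most [2 * M], so it is enough to
    approximate [g] in L1 by a continuous [phi], whose translates are controlled by
    [cont_shift_int]. *)
Lemma shift_sqr_small_bounded g M (N e : R) : measurable_fun setT g ->
  (forall x, `|g x| <= M) -> (forall x, N < `|x| -> g x = 0) -> 0 <= N -> 0 < e ->
  \forall h \near (0 : R), \int[mu]_x (g (x - h) - g x) ^+ 2 < e.
Proof.
move=> mg gM gN N0 e0.
have M0 : 0 <= M by rewrite (le_trans _ (gM 0)).
(* Two units of room: for [|h| < 1] and [|x| <= N + 1] both [x] and [x - h] lie in [A], while for
   [N + 1 < |x|] both values of [g] are zero. *)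
pose A : set R := `[- (N + 2), N + 2]%classic.
have mA : measurable A by exact: measurable_itv.
have Afin : (mu A < +oo)%E by exact: itv_fin.
have Lg : L2 g.
  apply: (@L2_le _ _ (fun x => M * \1_A x)) => //; first exact/L2Zl/indic_L2.
  move=> x; have [xN|/gN ->] := leP `|x| N; last by rewrite normr0.
  rewrite indicE mem_set ?mulr1 ?(le_trans (gM x)) ?ler_norm//.
  by rewrite /A/= in_itv/= -ler_norml; lra.
have ig : mu.-integrable A (EFin \o g) by exact: L2_integrableS.
(* The error of [phi] is counted twice, at [x] and at [x - h], and the increment of [phi] once, with
   tolerance [e / (4 * (M + 1))]. After multiplication by [2 * M] the total stays below [e]. *)
have d0 : 0 < e / (8 * (M + 1)) by rewrite divr_gt0// mulr_gt0// ltr_wpDl.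
have [phi_ [cphi_ iphi_ phi0]] := approximation_continuous_integrable mA Afin ig.
have [n phin] : exists n, (\int[mu]_(z in A) `|(g z - phi_ n z)%:E| < (e / (8 * (M + 1)))%:E)%E.
  move: phi0 => /fine_cvgP[nf /cvgrPdist_lt /(_ _ d0) nd].
  have [n [nfn ndn]] := filter_ex (filterI nf nd).
  exists n; rewrite -(fineK nfn) lte_fin; move: ndn => /=.
  by rewrite sub0r normrN; apply: le_lt_trans; exact: ler_norm.
pose phi := phi_ n; pose k := (fun x => `|g x - phi x|) \_ A.
have mA' : measurable (A : set (measurableTypeR R)) by exact: mA.
have ik : intg k.
  have : mu.-integrable A (EFin \o (fun x => `|g x - phi x|)).
    have := integrable_norm (integrableB mA' ig (iphi_ n)).
    exact: eq_integrable.
  move=> /(intg_restrict _ mA); exact.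
have k0 x : 0 <= k x by rewrite /k patchE; case: ifP.
have kint : \int[mu]_x k x < e / (8 * (M + 1)).
  rewrite -Rintegral_mkcond /Rintegral -lte_fin fineK//; apply: integrable_fin_num => //.
  exact: integrable_norm (integrableB mA' ig (iphi_ n)).
have cphi : continuous phi by exact: cphi_.
have d1 : 0 < e / (4 * (M + 1)) by rewrite divr_gt0// mulr_gt0// ltr_wpDl.
pose B : set R := `[- (N + 1), N + 1]%classic.
pose r h := (fun x => `|phi (x - h) - phi x|) \_ B.
near=> h.
have h1 : `|h| < 1.
  by near: h; exact: near0_norm.
have rint : \int[mu]_x r h x < e / (4 * (M + 1)).
  rewrite -Rintegral_mkcond; near: h.
  exact: (cvgr_lt 0 (@cont_shift_int phi (N + 1) cphi)).
have ir : intg (r h).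
  have : mu.-integrable B (EFin \o (fun x => `|phi (x - h) - phi x|)).
    apply: continuous_compact_integrable; first exact: segment_compact.
    apply: continuous_subspaceT => x; apply: cvg_norm; apply: cvgB; last exact: cphi.
    by apply: continuous_comp; [apply: cvgB; [exact: cvg_id|exact: cvg_cst]|exact: cphi].
  move=> /(intg_restrict _ (measurable_itv _)); exact.
have Hpt x : (g (x - h) - g x) ^+ 2 <= 2 * M * (k (x - h) + k x + r h x).
  have r0 : 0 <= r h x by rewrite /r patchE; case: ifP.
  have H1 : `|g (x - h) - g x| <= k (x - h) + k x + r h x.
    have [xN|xN] := leP `|x| (N + 1).
      have xA : x \in A by rewrite mem_set// /A/= in_itv/= -ler_norml; lra.
      have xhA : x - h \in A.
        rewrite mem_set// /A/= in_itv/= -ler_norml (le_trans (ler_normB _ _))//; lra.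
      have xB : x \in B by rewrite mem_set// /B/= in_itv/= -ler_norml.
      rewrite /k /r !patchE xA xhA xB.
      have -> : g (x - h) - g x = (g (x - h) - phi (x - h)) - (g x - phi x) + (phi (x - h) - phi x) by ring.
      by rewrite (le_trans (ler_normD _ _))// lerD2r ler_normB.
    rewrite (gN x) ?(gN (x - h)) ?subrr ?normr0 ?addr_ge0//; last lra.
    have := lerB_dist x h; lra.
  have H2 : `|g (x - h) - g x| <= 2 * M.
    by rewrite (le_trans (ler_normB _ _))// mulr_natl mulr2n lerD.
  rewrite -(real_normK (num_real _)) expr2.
  by apply: ler_pM.
have i1 : intg (fun x => k (x - h) + k x + r h x).
  by apply: intgD => //; apply: intgD => //; exact: intg_shift.
apply: (@le_lt_trans _ _ (\int[mu]_x (2 * M * (k (x - h) + k x + r h x)))).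
  apply: Rint_le => //; last exact: intgZl.
  exact: (L2_sqr (L2B (L2_shift h Lg) Lg)).
rewrite RintZl// RintD//; last by apply: intgD => //; exact: intg_shift.
rewrite RintD//; last exact: intg_shift.
rewrite Rint_shift//.
set K := \int[mu]_x k x in kint *; set L := \int[mu]_x r h x in rint *.
have M1 : 0 < M + 1 by rewrite ltr_wpDl.
move: kint rint; rewrite !ltr_pdivlMr ?mulr_gt0// => kint rint.
have K0 : 0 <= K by apply: Rintegral_ge0.
have L0 : 0 <= L by apply: Rintegral_ge0 => x _; rewrite /r patchE; case: ifP.
nra.
Unshelve. all: by end_near. Qed.

(** Truncation at level [n] in both the variable and the value. At each point the truncations
    eventually equal [f], and [f^2] dominates the squared errors. *)
Lemma L2_truncate f e : L2 f -> 0 < e -> exists g M N,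
  [/\ measurable_fun setT g, (forall x, `|g x| <= M), (forall x, N < `|x| -> g x = 0),
      0 <= N & \int[mu]_x (f x - g x) ^+ 2 < e].
Proof.
move=> Lf e0; have mf := L2_meas Lf.
pose B (n : nat) : set R := `[- n%:R, n%:R]%classic `&` (f @^-1` `[- n%:R, n%:R]%classic).
have mB n : measurable (B n).
  apply: measurableI; first exact: measurable_itv.
  by rewrite -[X in measurable X]setTI; apply: mf => //; exact: measurable_itv.
pose g n := f \_ (B n).
have mg n : measurable_fun setT (g n).
  apply/(measurable_restrictT _ _).1 => //; exact: measurable_funTS.
have BP n x : (x \in B n) = (`|x| <= n%:R) && (`|f x| <= n%:R).
  by apply/idP/andP; rewrite inE /B/= !in_itv/= -!ler_norml => -[].
have : (\int[mu]_x (f x - g n x) ^+ 2) @[n --> \oo] --> \int[mu]_(x in [set: R]) (0 : R).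
  apply: (@Rint_dct _ _ _ (fun x => f x ^+ 2)).
  - by move=> n; apply: measurable_funX; exact: measurable_funB.
  - move=> x; apply: cvg_near_cst; near=> n.
    rewrite /g patchE BP; case: ifPn => [_|]; first by rewrite subrr expr0n.
    rewrite negb_and -!ltNge => /orP[] H.
      exfalso; have : `|x| <= n%:R by near: n; exact: nbhs_infty_ger.
      by rewrite leNgt H.
    exfalso; have : `|f x| <= n%:R by near: n; exact: nbhs_infty_ger.
    by rewrite leNgt H.
  - exact: L2_sqr.
  - move=> n x; rewrite ger0_norm ?sqr_ge0// /g patchE; case: ifP => _.
      by rewrite subrr expr0n sqr_ge0.
    by rewrite subr0.
rewrite Rintegral_cst// mul0r => /cvgrPdist_lt/(_ _ e0)/filter_ex[n].
rewrite sub0r normrN ger0_norm; last by apply: Rintegral_ge0 => x _; exact: sqr_ge0.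
move=> Hn; exists (g n), n%:R, n%:R; split => //.
- by move=> x; rewrite /g patchE BP; case: ifP => [/andP[]//|_]; rewrite normr0.
- by move=> x nx; rewrite /g patchE BP leNgt nx.
Unshelve. all: by end_near. Qed.

(** Translation invariance of the integral reduces the claim to shifts tending to [0], where [f] is
    replaced by a bounded truncation with bounded support. *)
Lemma L2_shift_cvg f a : L2 f -> L2cvg (nbhs a) (fun s x => f (x - s)) (fun x => f (x - a)).
Proof.
move=> Lf.
have H0 : \int[mu]_x (f (x - h) - f x) ^+ 2 @[h --> (0 : R)] --> (0 : R).
  apply/cvgrPdist_lt => e e0.
  (* The increment of [f] is at most [3 (p^2 + q^2 + r^2)] in square. Here [p] and [q] are the
     truncation error and its translate, with equal integrals below [e / 12], and the increment [r]
     of the truncation gets [e / 6]. *)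
  have e12 : 0 < e / 12 by rewrite divr_gt0.
  have e6 : 0 < e / 6 by rewrite divr_gt0.
  have [g [M [N [mg gM gN N0 fg]]]] := L2_truncate Lf e12.
  have Lg : L2 g.
    apply: (@L2_le _ _ (fun x => M * \1_(`[- N, N] : set R) x)) => //.
      by apply: L2Zl; apply: indic_L2; [exact: measurable_itv|exact: itv_fin].
    move=> x; have [xN|/gN ->] := leP `|x| N; last by rewrite normr0.
    rewrite indicE mem_set ?mulr1 ?(le_trans (gM x)) ?ler_norm//=.
    by rewrite in_itv/= -ler_norml.
  near=> h.
  rewrite sub0r normrN ger0_norm; last by apply: Rintegral_ge0 => x _; exact: sqr_ge0.
  have gs : \int[mu]_x (g (x - h) - g x) ^+ 2 < e / 6.
    by near: h; exact: shift_sqr_small_bounded gM gN N0 e6.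
  have i1 := L2_sqr (L2B Lf Lg).
  have i2 := intg_shift h i1.
  have i3 := L2_sqr (L2B (L2_shift h Lg) Lg).
  apply: (@le_lt_trans _ _ (\int[mu]_x (3 * ((f x - g x) ^+ 2 + (f (x - h) - g (x - h)) ^+ 2
     + (g (x - h) - g x) ^+ 2)))).
    apply: Rint_le.
    - exact: (L2_sqr (L2B (L2_shift h Lf) Lf)).
    - by apply: intgZl; apply: intgD => //; exact: intgD.
    - move=> x; set p := f x - g x; set q := f (x - h) - g (x - h); set r := g (x - h) - g x.
      have -> : f (x - h) - f x = q + r - p by rewrite /p /q /r; ring.
      have := sqr_ge0 (p + q); have := sqr_ge0 (p + r); have := sqr_ge0 (q - r); nra.
  rewrite RintZl; last by apply: intgD => //; exact: intgD.
  rewrite RintD//; last exact: intgD.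
  rewrite RintD// (Rint_shift h i1); lra.
apply: (@L2cvg_intro _ _ _ _ _ _ (fun s => \int[mu]_x (f (x - (s - a)) - f x) ^+ 2)).
- by apply: nearW => s; exact: L2_shift.
- exact: L2_shift.
- apply: nearW => s; rewrite le_eqVlt; apply/orP; left; apply/eqP.
  rewrite -(@Rint_shift _ a (fun x => (f (x - (s - a)) - f x) ^+ 2)).
    by apply: Rint_eq => x; rewrite opprB addrA subrK.
  exact: (L2_sqr (L2B (L2_shift (s - a) Lf) Lf)).
- have : (s - a) @[s --> a] --> (0 : R).
    by rewrite -[X in _ --> X](subrr a); apply: cvgB; [exact: cvg_id|exact: cvg_cst].
  by move=> Hs; exact: (@cvg_comp _ _ _ (fun s => s - a) (fun h => \int[mu]_x (f (x - h) - f x) ^+ 2) _ _ _ Hs H0).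
Unshelve. all: by end_near. Qed.

End TranslationContinuity.

(** * Weak derivatives in time *)

Section OneVariable.
Context {R : realType}.
Notation mu := (@lebesgue_measure R).
Implicit Types (f g : R -> R) (a c h : R).

(** Covers every sign of [h], hence the location of the intermediate point by [|xi - a| <= |h|]. *)
Lemma mvt f df a h : has_deriv f df ->
  exists2 xi, `|xi - a| <= `|h| & f (a + h) - f a = h * df xi.
Proof.
move=> Hf; have cf := has_deriv_continuous Hf.
have [h0|h0] := leP 0 h.
  have [|x _||xi] := @MVT_segment R f df a (a + h).
  - by rewrite lerDl.
  - exact: Hf.
  - exact: continuous_subspaceT.
  rewrite in_itv/= => /andP[x1 x2] ->; exists xi; last by ring.
  by rewrite !ger0_norm//; lra.
have [|x _||xi] := @MVT_segment R f df (a + h) a.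
- by lra.
- exact: Hf.
- exact: continuous_subspaceT.
rewrite in_itv/= => /andP[x1 x2] E; exists xi; last first.
  by apply/eqP; rewrite -eqr_opp opprB E; apply/eqP; ring.
by rewrite (ltr0_norm h0) ler0_norm; lra.
Qed.

(** Two mean value steps; they give the constant [C] in place of the sharp [C / 2], and only the
    order [h ^+ 2] matters. *)
Lemma taylor2 f f1 f2 C a h : has_deriv f f1 -> has_deriv f1 f2 ->
  (forall x, `|f2 x| <= C) -> `|f (a + h) - f a - h * f1 a| <= C * h ^+ 2.
Proof.
move=> H1 H2 fC; have [xi xia ->] := mvt a h H1.
have [ze _ E] := mvt a (xi - a) H2.
rewrite (_ : a + (xi - a) = xi) in E; last by ring.
rewrite -mulrBr E !normrM mulrA -[h ^+ 2](real_normK (num_real h)) expr2 mulrC.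
by apply: ler_pM; rewrite ?mulr_ge0 ?fC//; exact: ler_wpM2l.
Qed.

(** The value at [h = 0] is the limit of the quotients, so that they converge along the full
    neighbourhood of [0] and not only the punctured one. The increment of [2 * b] that is later
    substituted for [h] may vanish at times arbitrarily close to the base time. *)
Definition diffq f f1 h y := if h == 0 then f1 y else (f (y + h) - f y) / h.

Lemma diffqE f f1 h y : f (y + h) - f y = h * diffq f f1 h y.
Proof.
rewrite /diffq; case: eqP => [->|/eqP h0]; first by rewrite addr0 subrr mul0r.
by rewrite mulrC divfK.
Qed.

Lemma int_indic_itv a c : a <= c -> \int[mu]_x (\1_(`[a, c]%classic : set R) x : R) = c - a.
Proof.
move=> ac; rewrite /Rintegral integral_indic//= setIT lebesgue_measure_itv/= lte_fin.
by move: ac; rewrite le_eqVlt => /predU1P[->|->//]; rewrite ltxx subrr.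
Qed.

Lemma diffq_L2cvg f : test1 f ->
  L2cvg (nbhs (0 : R)) (diffq f (derive1 (f : R -> R^o))) (derive1 (f : R -> R^o)).
Proof.
move=> tf; set f1 := derive1 _.
have tf1 : test1 f1 := test1_derive1 tf.
have [C C0 fC] := test1_bounded (test1_derive1 tf1).
have [X fX] := test1_supp tf; have [X1 f1X] := test1_supp tf1.
(* Contains both supports with one unit to spare, so that for [|h| < 1] the term [f (x + h)]
   vanishes outside as well. *)
pose Y := `|X| + `|X1| + 1.
have Y0 : 0 <= Y by rewrite !addr_ge0.
have mY : measurable (`[- Y, Y]%classic : set R) by exact: measurable_itv.
have Lq h : L2 (diffq f f1 h).
  rewrite /diffq; case: eqP => _; first exact: test1_L2.
  have := L2Zl h^-1 (L2B (L2_shift (- h) (test1_L2 tf)) (test1_L2 tf)).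
  by under eq_fun do rewrite opprK mulrC.
apply: (@L2cvg_intro _ _ _ _ _ _ (fun h => (C ^+ 2 * (Y - - Y)) * h ^+ 2)).
- exact: nearW.
- exact: test1_L2.
- near=> h.
  have h1 : `|h| < 1 by near: h; exact: near0_norm.
  have i1 := indic_intg mY (itv_fin _ _ _ _).
  have -> : C ^+ 2 * (Y - - Y) * h ^+ 2 = \int[mu]_x ((C ^+ 2 * h ^+ 2) * \1_(`[- Y, Y]%classic : set R) x).
    by rewrite RintZl// int_indic_itv; [ring|lra].
  apply: Rint_le; [exact: (L2_sqr (L2B (Lq h) (test1_L2 tf1)))|exact: intgZl|].
  move=> x; rewrite indicE; have [xY|xY] := boolP (- Y <= x <= Y).
    rewrite mem_set/= ?in_itv//= mulr1 -exprMn.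
    have T := taylor2 x h (smooth1_has_deriv tf.1) (smooth1_has_deriv tf1.1) fC.
    have : `|diffq f f1 h x - f1 x| <= C * `|h|.
      have [->|h0] := eqVneq h 0; first by rewrite /diffq eqxx subrr !normr0 mulr0.
      rewrite (diffqE f f1) -mulrBr normrM -(real_normK (num_real h)) expr2 mulrCA in T.
      by rewrite ler_pM2l ?normr_gt0 in T.
    move=> H; rewrite -(real_normK (num_real (_ - _))) -[X in _ <= X](real_normK (num_real _)).
    by rewrite ler_pXn2r ?nnegrE// normrM (ger0_norm C0).
  rewrite memNset/= ?in_itv/=; last exact/negP.
  have xn : Y < `|x| by rewrite ltNge; apply: contra xY; rewrite ler_norml.
  have f1x : f1 x = 0.
    apply: f1X; rewrite -ler_norml -ltNge (le_lt_trans _ xn)// /Y.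
    by have := ler_norm X1; have := normr_ge0 X; lra.
  have fx : f x = 0.
    apply: fX; rewrite -ler_norml -ltNge (le_lt_trans _ xn)// /Y.
    by have := ler_norm X; have := normr_ge0 X1; lra.
  have fxh : f (x + h) = 0.
    apply: fX; rewrite -ler_norml -ltNge.
    have := lerB_normD x h; have := ler_norm X; have := normr_ge0 X1.
    by rewrite /Y in xn; lra.
  rewrite /diffq f1x fx fxh subrr mul0r.
  by case: ifP; rewrite subr0 expr0n mulr0.
- rewrite -[X in _ --> X](mulr0 (C ^+ 2 * (Y - - Y))); apply: cvgMr.
  rewrite -[X in _ --> X](mulr0 0); under eq_fun do rewrite expr2.
  by apply: cvgM; exact: cvg_id.
Unshelve. all: by end_near. Qed.

Lemma int_deriv_cpt F f X : has_deriv F f -> continuous f ->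
  (forall x, ~~ (- X <= x <= X) -> F x = 0) -> \int[mu]_x f x = 0.
Proof.
move=> HF cf F0; pose Y := `|X| + 1.
have XY : X < Y by rewrite /Y; have := ler_norm X; lra.
have Y0 : - Y < Y by rewrite /Y; have := normr_ge0 X; lra.
have cF := has_deriv_continuous HF.
have f0 := derive1_supp F0; rewrite (has_deriv_derive1 HF) in f0.
have fY x : ~ (`[- Y, Y]%classic : set R) x -> f x = 0.
  move=> /= xY; apply: f0; apply: contra_notN xY => /andP[x1 x2].
  by rewrite in_itv/=; apply/andP; split; lra.
rewrite -(Rint_supp (measurable_itv _) fY) /Rintegral.
rewrite (@continuous_FTC2 _ f F (- Y) Y)//=.
- by rewrite !F0 ?subr0//; apply/negP => /andP[]; lra.
- exact: continuous_subspaceT.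
- split; [by move=> x _; have [] := HF x| |].
    by apply: cvg_at_right_filter; exact: cF.
  by apply: cvg_at_left_filter; exact: cF.
- by move=> x _; rewrite (has_deriv_derive1 HF).
Qed.

(** Masses and fluxes are known to be continuous only at positive times. A factor supported there
    makes the product continuous on the whole line, since elsewhere it is locally zero. *)
Lemma cont_mul_supp f g a c : continuous f ->
  (forall x, ~~ (a <= x <= c) -> f x = 0) ->
  (forall x, a <= x <= c -> {for x, continuous g}) ->
  continuous (fun x => f x * g x).
Proof.
move=> cf f0 cg x; have [xac|xac] := boolP (a <= x <= c).
  by apply: cvgM; [exact: cf|exact: cg].
have fx : f x = 0 by exact: f0.
have N : \forall y \near x, ~~ (a <= y <= c).
  move: xac; rewrite negb_and -!ltNge => /orP[] H.
    have : \forall y \near x, y < a by exact: (cvgr_lt x (@cvg_id _ (nbhs x))).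
    by apply: filterS => y ya; rewrite negb_and -!ltNge ya.
  have : \forall y \near x, c < y by exact: (cvgr_gt x (@cvg_id _ (nbhs x))).
  by apply: filterS => y ya; rewrite negb_and -!ltNge ya orbT.
rewrite /prop_for /continuous_at fx mul0r; apply: cvg_near_cst.
by move: N; apply: filterS => y /f0 ->; rewrite mul0r.
Qed.

(* Rescaling one bump around [t0] reads off the derivative of [d] at [t0]. *)
Lemma weak_derivative_at (d M : R -> R) (t0 D r : R) : 0 < r ->
  (forall t, `|t - t0| < r -> {for t, continuous d} /\ {for t, continuous M}) ->
  d t0 = 0 -> k^-1 * d (t0 + k) @[k --> (0 : R)^'] --> D ->
  (forall theta, test1 theta ->
     (exists2 rho, rho < r & forall t, ~~ (t0 - rho <= t <= t0 + rho) -> theta t = 0) ->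
     \int[mu]_t (derive1 (theta : R -> R^o) t * d t + theta t * M t) = 0) ->
  D = M t0.
Proof.
move=> r0 cdM d0 dD Hweak.
pose B := @bump R 1 (-1) 1.
have tB : test1 B by exact: bump_test.
have [C C0 BC] := test1_bounded (test1_derive1 tB).
(* On the middle half of the support each of the two factors of [B] is at least [expR (- 2)]. *)
pose b0 : R := expR (- 4).
have b00 : 0 < b0 by exact: expR_gt0.
have BL s : - 2^-1 <= s <= 2^-1 -> b0 <= B s.
  move=> /andP[s1 s2]; rewrite /B /bump /flat !mul1r opprK !ifT; [|lra..].
  rewrite expr0 invr1 !mul1r -expRD ler_expR -opprD lerN2.
  have H (y : R) : 2^-1 <= y -> y^-1 <= 2.
    by move=> y2; rewrite -[leRHS]invrK lef_pV2// posrE; lra.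
  have := H (s + 1); have := H (1 - s); lra.
(* For the bump of radius [rho] the error integral is at most [2 * (C + 1) * e * rho] and the mass
   of the bump at least [rho * b0]; the radius cancels in the quotient. *)
pose K := 2 * (C + 1) / b0.
have K0 : 0 < K by rewrite divr_gt0// mulr_gt0// ltr_wpDl.
suff key e : 0 < e -> `|M t0 - D| <= K * e.
  apply/eqP; rewrite eq_sym -subr_eq0 -normr_le0; apply/ler_addgt0Pr => e e0.
  have := key (e / K) (divr_gt0 e0 K0).
  by rewrite add0r (_ : K * (e / K) = e)//; field; rewrite gt_eqF.
move=> e0.
have nD : \forall k \near (0 : R), `|d (t0 + k) - D * k| <= e * `|k|.
  have nD0 : \forall k \near (0 : R), k != 0 -> `|D - k^-1 * d (t0 + k)| < e.
    by move/cvgrPdist_lt : dD => /(_ _ e0).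
  near=> k; have Hk : k != 0 -> `|D - k^-1 * d (t0 + k)| < e by near: k.
  have [->|k0] := eqVneq k 0.
    by rewrite addr0 d0 mulr0 subrr normr0 mulr0.
  have -> : d (t0 + k) - D * k = - (k * (D - k^-1 * d (t0 + k))).
    by rewrite mulrBr mulrA divff// mul1r opprB mulrC.
  by rewrite normrN normrM mulrC ler_wpM2r// ltW// Hk.
have nM : \forall k \near (0 : R), `|M (t0 + k) - M t0| <= e.
  have [|_ cM] := cdM t0; first by rewrite subrr normr0.
  move/cvgrPdist_lt : cM => /(_ _ e0) /nbhs_ballP[del /= del0 H].
  exists del => //= k; rewrite /ball/= sub0r normrN => kd; rewrite distrC ltW//; apply: H.
  by rewrite /ball/= opprD addrA subrr sub0r normrN.
have [rho /= rho0 Hrho] : exists2 rho, 0 < rho < r & forall k, `|k| <= rho ->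
    `|d (t0 + k) - D * k| <= e * `|k| /\ `|M (t0 + k) - M t0| <= e.
  have nDM : \forall k \near (0 : R), `|d (t0 + k) - D * k| <= e * `|k| /\
      `|M (t0 + k) - M t0| <= e by near=> k; split; near: k.
  case/nbhs_ballP : nDM => del /= del0 H.
  exists (Num.min del r / 2).
    have m0 : 0 < Num.min del r by rewrite lt_min del0.
    have m1 : Num.min del r <= r by rewrite ge_min lexx orbT.
    by apply/andP; split; lra.
  move=> k kr; apply: H; rewrite /ball/= sub0r normrN.
  have m0 : Num.min del r <= del by rewrite ge_min lexx.
  have m1 : 0 < Num.min del r by rewrite lt_min del0.
  lra.
have {rho0}[rho0 rhor] := andP rho0.
pose th t := B (rho^-1 * t + (- (rho^-1 * t0))).
have thE t : th t = B ((t - t0) / rho) by rewrite /th; congr B; ring.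
have dth : has_deriv th (fun t => rho^-1 * derive1 (B : R -> R^o) ((t - t0) / rho)).
  move=> t; have E : (t - t0) / rho = rho^-1 * t + (- (rho^-1 * t0)) by ring.
  by rewrite E; exact: (@has_deriv_aff _ rho^-1 (- (rho^-1 * t0)) _ _ (smooth1_has_deriv tB.1) t).
have Bout s : ~~ (-1 <= s <= 1) -> B s = 0.
  move=> s1; apply: bump_out => //; apply: contra s1 => /andP[? ?].
  by apply/andP; split; lra.
have th0 t : ~~ (t0 - rho <= t <= t0 + rho) -> th t = 0.
  move=> tr; rewrite thE Bout//; apply: contra tr.
  by rewrite ler_pdivlMr// ler_pdivrMr// => /andP[? ?]; apply/andP; split; lra.
have sth : smooth1 th by exact: smooth1_aff tB.1.
have tth : test1 th.
  split=> //; exists (`|t0| + rho) => t tt; apply: th0; apply/negP => /andP[t1 t2].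
  suff : `|t| <= `|t0| + rho by lra.
  by rewrite ler_norml; have := ler_norm t0; have := lerNnormlW (lexx `|t0|); lra.
pose th1 := derive1 (th : R -> R^o).
have th1E t : th1 t = rho^-1 * derive1 (B : R -> R^o) ((t - t0) / rho).
  by rewrite /th1 (has_deriv_derive1 dth).
have th10 := derive1_supp th0; rewrite -/th1 in th10.
have cth := test1_cont tth; have cth1 := test1_cont (test1_derive1 tth).
have clos t : t0 - rho <= t <= t0 + rho -> {for t, continuous d} /\ {for t, continuous M}.
  by move=> /andP[t1 t2]; apply: cdM; rewrite ltr_norml; apply/andP; split; lra.
pose lin t := D * (t - t0).
have clin : continuous lin.
  by move=> t; apply: cvgMr; apply: cvgB; [exact: cvg_id|exact: cvg_cst].
have supp_intg f g : continuous f -> (forall x, ~~ (t0 - rho <= x <= t0 + rho) -> f x = 0) ->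
    (forall x, t0 - rho <= x <= t0 + rho -> {for x, continuous g}) ->
    intg (fun t => f t * g t).
  move=> cf f0 cg; apply: (@cont_cpt_intg _ _ (t0 - rho) (t0 + rho)).
    exact: cont_mul_supp cf f0 cg.
  by move=> x /f0 ->; rewrite mul0r.
have i1 : intg (fun t => th1 t * d t) by apply: supp_intg => // t /clos[].
have i2 : intg (fun t => th t * M t) by apply: supp_intg => // t /clos[].
have i3 : intg (fun t => th1 t * lin t) by apply: supp_intg => // t _; exact: clin.
have i4 : intg th by exact: test1_intg.
have E1 : \int[mu]_t (th1 t * d t + th t * M t) = 0.
  by apply: Hweak => //; exists rho.
(* The linear part [lin] of [d] satisfies the weak identity exactly, with derivative [D].
   Subtracting it leaves only errors that are small on the support of [th]. *)
have E2 : \int[mu]_t (th1 t * (t - t0) + th t) = 0.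
  have H1 : has_deriv (fun t => t - t0) (fun _ => 1).
    by move=> t; have H := is_deriveB (is_derive_id t (1 : R)) (is_derive_cst t0 t (1 : R)); apply: is_derive_eq H _; rewrite subr0.
  have H := has_derivM (smooth1_has_deriv sth) H1.
  have := @int_deriv_cpt _ _ (`|t0| + rho) H.
  rewrite (_ : (fun x => _ + th x * 1) = fun t => th1 t * (t - t0) + th t); last first.
    by apply/funext => t; rewrite mulr1.
  apply.
    move=> t; apply: cvgD; last exact: cth.
    by apply: cvgM; [exact: cth1|apply: cvgB; [exact: cvg_id|exact: cvg_cst]].
  move=> t tt; rewrite th0 ?mul0r//; apply: contra tt => /andP[t1 t2].
  by apply/andP; have := ler_norm t0; have := lerNnormlW (lexx `|t0|); split; lra.
have thint : rho * b0 <= \int[mu]_t th t.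
  have -> : rho * b0 = \int[mu]_t (b0 * \1_(`[t0 - rho / 2, t0 + rho / 2]%classic : set R) t).
    rewrite RintZl; last by apply: indic_intg; [exact: measurable_itv|exact: itv_fin].
    by rewrite int_indic_itv; [field|lra].
  apply: Rint_le => //.
    by apply: intgZl; apply: indic_intg; [exact: measurable_itv|exact: itv_fin].
  move=> t; rewrite indicE; have [tr|tr] := boolP (t0 - rho / 2 <= t <= t0 + rho / 2).
    rewrite mem_set/= ?in_itv//= mulr1 thE; apply: BL; rewrite ler_pdivlMr// ler_pdivrMr//.
    by move: tr => /andP[? ?]; apply/andP; split; lra.
  rewrite memNset/= ?in_itv/=; last exact/negP.
  by rewrite mulr0 thE; have /andP[] := bump_bnd 1 (-1) 1 ((t - t0) / rho).
have ind_i : intg (\1_(`[t0 - rho, t0 + rho]%classic : set R) : R -> R).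
  by apply: indic_intg; [exact: measurable_itv|exact: itv_fin].
(* On the support [|th1| <= C / rho] and [|d - lin| <= e * rho], so their product is at most
   [C * e]. The term with [M] adds at most [e], and the support has length [2 * rho]. *)
have main : `|(M t0 - D) * \int[mu]_t th t| <= (C + 1) * e * (rho + rho).
  have -> : (M t0 - D) * \int[mu]_t th t =
      - \int[mu]_t (th1 t * (d t - lin t) + th t * (M t - M t0)).
    have j1 : intg (fun t => th1 t * (t - t0)).
      by apply: supp_intg => // t _; apply: cvgB; [exact: cvg_id|exact: cvg_cst].
    have -> : \int[mu]_t (th1 t * (d t - lin t) + th t * (M t - M t0)) =
       \int[mu]_t ((th1 t * d t + th t * M t) - (D * (th1 t * (t - t0) + th t) + (M t0 - D) * th t)).
      by apply: Rint_eq => t; rewrite /lin; ring.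
    have j2 : intg (fun t => th1 t * (t - t0) + th t) by exact: intgD.
    have j3 : intg (fun t => D * (th1 t * (t - t0) + th t)) by exact: intgZl.
    have j4 : intg (fun t => (M t0 - D) * th t) by exact: intgZl.
    rewrite RintB; [|exact: intgD|exact: intgD].
    by rewrite E1 (RintD j3 j4) (RintZl _ j2) (RintZl _ i4) E2; ring.
  have -> : (C + 1) * e * (rho + rho) =
      \int[mu]_t ((C + 1) * e * \1_(`[t0 - rho, t0 + rho]%classic : set R) t).
    by rewrite RintZl// int_indic_itv; [ring|lra].
  rewrite normrN; apply: Rint_norm_le.
  - apply: intgD; apply: supp_intg => // t /clos[c1 c2].
      by apply: cvgB => //; exact: clin.
    by apply: cvgB => //; exact: cvg_cst.
  - exact: intgZl.
  - move=> t; rewrite indicE; have [tr|tr] := boolP (t0 - rho <= t <= t0 + rho); last first.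
      rewrite memNset/= ?in_itv/=; last exact/negP.
      by rewrite th0// th10// !mul0r addr0 normr0 mulr0.
    rewrite mem_set/= ?in_itv//= mulr1.
    have tk : `|t - t0| <= rho.
      by rewrite ler_norml; move: tr => /andP[? ?]; apply/andP; split; lra.
    have tE : t0 + (t - t0) = t by ring.
    have [H1 H2] := Hrho _ tk; rewrite tE in H1 H2.
    rewrite (le_trans (ler_normD _ _))// (normrM (th1 t)) (normrM (th t)) (mulrDl C); apply: lerD.
      rewrite th1E normrM (ger0_norm (x := rho^-1)); last by rewrite invr_ge0 ltW.
      have H3 : `|d t - lin t| <= e * rho by rewrite (le_trans H1)// ler_pM2l.
      have := BC ((t - t0) / rho); set w := `|derive1 _ _| => wC.
      have w0 : 0 <= w by exact: normr_ge0.
      have -> : C * e = rho^-1 * C * (e * rho) by field; rewrite gt_eqF.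
      apply: ler_pM => //; first by rewrite mulr_ge0// invr_ge0 ltW.
      by rewrite ler_wpM2l// invr_ge0 ltW.
    have Hth : `|th t| <= 1.
      by rewrite thE; have /andP[B0 B1] := bump_bnd 1 (-1) 1 ((t - t0) / rho); rewrite ger0_norm.
    by apply: ler_pM.
set I := \int[mu]_t th t in thint main.
have I0 : 0 < I by apply: lt_le_trans thint; rewrite mulr_gt0.
rewrite normrM (gtr0_norm I0) in main.
have H : `|M t0 - D| * (rho * b0) <= (C + 1) * e * (rho + rho).
  by apply: le_trans main; rewrite ler_wpM2l.
have -> : K * e = ((C + 1) * e * (rho + rho)) / (rho * b0).
  by rewrite /K; field; rewrite !gt_eqF.
by rewrite ler_pdivlMr// mulr_gt0.
Unshelve. all: by end_near. Qed.

End OneVariable.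

(** * The flux of a weak solution *)

Section FluxIdentity.
Context {R : realType}.
Notation mu := (@lebesgue_measure R).
Notation dd f := (derive1 (f : R -> R^o)).
Implicit Types (f g u v w ux vx wx psi theta : R -> R) (a c t : R).

(** Weak convergence in L1, tested by bounded measurable functions: this is what products of two
    strongly L2-convergent families satisfy, and the coefficients of the equation are quadratic. *)
Definition L1wcvg {T : Type} (F : set_system T) (f : T -> R -> R) (f0 : R -> R) :=
  [/\ \forall s \near F, intg (f s), intg f0 &
      forall (psi : R -> R) M, measurable_fun setT psi -> (forall x, `|psi x| <= M) ->
        (\int[mu]_x (f s x * psi x)) @[s --> F] --> \int[mu]_x (f0 x * psi x)].

Section WeakL1.
Context {T : Type} (F : set_system T) {FF : Filter F}.
Implicit Types (k l : T -> R -> R).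

(** The bounded weight is absorbed into one factor, which still converges strongly in L2. *)
Lemma L1wcvgM k l f g : L2cvg F k f -> L2cvg F l g ->
  L1wcvg F (fun s x => k s x * l s x) (fun x => f x * g x).
Proof.
move=> ck cl; have [Lk Lf _] := ck; have [Ll Lg _] := cl; split.
- by near=> s; apply: L2M_intg; near: s.
- exact: L2M_intg.
move=> psi M mpsi psiM.
have -> : (fun s => \int[mu]_x (k s x * l s x * psi x)) = (fun s => \int[mu]_x (k s x * psi x * l s x)).
  by apply/funext => s; apply: Rint_eq => x; rewrite mulrAC.
have -> : \int[mu]_x (f x * g x * psi x) = \int[mu]_x (f x * psi x * g x).
  by apply: Rint_eq => x; rewrite mulrAC.
by apply: L2cvgM => //; apply: L2cvgMb mpsi psiM.
Unshelve. all: by end_near. Qed.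

Lemma L1wcvgD k l f g : L1wcvg F k f -> L1wcvg F l g ->
  L1wcvg F (fun s x => k s x + l s x) (fun x => f x + g x).
Proof.
move=> [ik jf ck] [il ig cl]; split.
- by near=> s; apply: intgD; near: s.
- exact: intgD.
move=> psi M mpsi psiM.
have -> : \int[mu]_x ((f x + g x) * psi x) = \int[mu]_x (f x * psi x) + \int[mu]_x (g x * psi x).
  rewrite -RintD; [|exact: intgM mpsi psiM|exact: intgM mpsi psiM].
  by apply: Rint_eq => x; rewrite mulrDl.
have H : (\int[mu]_x (k s x * psi x) + \int[mu]_x (l s x * psi x)) @[s --> F] -->
    \int[mu]_x (f x * psi x) + \int[mu]_x (g x * psi x).
  by apply: cvgD; [exact: ck psi M mpsi psiM|exact: cl psi M mpsi psiM].
apply: cvg_trans H; apply: near_eq_cvg; near=> s.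
have iks : intg (k s) by near: s.
have ils : intg (l s) by near: s.
rewrite /= -RintD; [|exact: intgM mpsi psiM|exact: intgM mpsi psiM].
by apply: Rint_eq => x; rewrite mulrDl.
Unshelve. all: by end_near. Qed.

Lemma L1wcvgZ c k f : L1wcvg F k f ->
  L1wcvg F (fun s x => c * k s x) (fun x => c * f x).
Proof.
move=> [ik jf ck]; split.
- by near=> s; apply: intgZl; near: s.
- exact: intgZl.
move=> psi M mpsi psiM.
have -> : \int[mu]_x (c * f x * psi x) = c * \int[mu]_x (f x * psi x).
  rewrite -RintZl; last exact: intgM mpsi psiM.
  by apply: Rint_eq => x; rewrite mulrA.
have H : (c * \int[mu]_x (k s x * psi x)) @[s --> F] --> c * \int[mu]_x (f x * psi x).
  by apply: cvgMr; exact: ck psi M mpsi psiM.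
apply: cvg_trans H; apply: near_eq_cvg; near=> s.
have iks : intg (k s) by near: s.
rewrite /= -RintZl; last exact: intgM mpsi psiM.
by apply: Rint_eq => x; rewrite mulrA.
Unshelve. all: by end_near. Qed.

Lemma L1wcvg_ext k l f g : (forall s x, k s x = l s x) -> (forall x, f x = g x) ->
  L1wcvg F k f -> L1wcvg F l g.
Proof.
move=> kl fg; have -> : k = l by apply/funext => s; apply/funext => x.
by have -> : f = g by apply/funext.
Qed.

End WeakL1.

(** [flA], [flB] and [flC] are the coefficients paired with the second, third and first space
    derivative of the test function; the factor [- 2^-1] of [flB] is left to [flux]. When [u], [v],
    [w] are even and their derivatives odd, [flA] is odd and the other two are even. *)
Definition flA v w ux x := ux x * (v x + w x).
Definition flB u x := u x ^+ 2.
Definition flC u v w ux vx wx x :=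
  3 / 2 * u x ^+ 2 + 2^-1 * ux x ^+ 2 + u x * (v x + w x)
  + ux x * (vx x + wx x)
  + 2^-1 * (v x ^+ 2 + w x ^+ 2 - vx x ^+ 2 - wx x ^+ 2).

Section FluxConvergence.
Context {T : Type} (F : set_system T) {FF : Filter F}.
Variables (u v w ux vx wx : T -> R -> R) (u0 v0 w0 ux0 vx0 wx0 : R -> R).
Hypothesis cu : L2cvg F u u0.
Hypothesis cv : L2cvg F v v0.
Hypothesis cw : L2cvg F w w0.
Hypothesis cux : L2cvg F ux ux0.
Hypothesis cvx : L2cvg F vx vx0.
Hypothesis cwx : L2cvg F wx wx0.

Lemma flA_cvg : L1wcvg F (fun s => flA (v s) (w s) (ux s)) (flA v0 w0 ux0).
Proof. exact: L1wcvgM cux (L2cvgD cv cw). Qed.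

Lemma flB_cvg : L1wcvg F (fun s => flB (u s)) (flB u0).
Proof. by apply: L1wcvg_ext (L1wcvgM cu cu) => *; rewrite /flB expr2. Qed.

Lemma flC_cvg : L1wcvg F (fun s => flC (u s) (v s) (w s) (ux s) (vx s) (wx s))
  (flC u0 v0 w0 ux0 vx0 wx0).
Proof.
(* [flC] expanded into multiples of products of two factors, the shape on which the convergence
   rules act. *)
pose e (u v w ux vx wx : R -> R) x := 3 / 2 * (u x * u x) + 2^-1 * (ux x * ux x)
  + u x * (v x + w x) + ux x * (vx x + wx x) + 2^-1 * (v x * v x) + 2^-1 * (w x * w x)
  + (- 2^-1) * (vx x * vx x) + (- 2^-1) * (wx x * wx x).
apply: (@L1wcvg_ext _ F (fun s => e (u s) (v s) (w s) (ux s) (vx s) (wx s)) _ (e u0 v0 w0 ux0 vx0 wx0)).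
- by move=> s x; rewrite /e /flC; ring.
- by move=> x; rewrite /e /flC; ring.
rewrite /e.
do 4 (apply: L1wcvgD; last by apply: L1wcvgZ; exact: L1wcvgM).
do 2 (apply: L1wcvgD; last by apply: L1wcvgM => //; exact: L2cvgD).
by apply: L1wcvgD; apply: L1wcvgZ; exact: L1wcvgM.
Qed.

End FluxConvergence.

Definition flux u v w ux vx wx psi :=
  \int[mu]_x (flA v w ux x * dd (dd psi) x)
  - 2^-1 * \int[mu]_x (flB u x * dd (dd (dd psi)) x)
  + \int[mu]_x (flC u v w ux vx wx x * dd psi x).

Lemma fluxE u v w ux vx wx psi p1 p2 p3 :
  dd psi = p1 -> dd (dd psi) = p2 -> dd (dd (dd psi)) = p3 ->
  flux u v w ux vx wx psi = \int[mu]_x (flA v w ux x * p2 x)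
    - 2^-1 * \int[mu]_x (flB u x * p3 x) + \int[mu]_x (flC u v w ux vx wx x * p1 x).
Proof. by move=> <- <- <-. Qed.

Section FluxIntegrable.
Context {u v w ux vx wx : R -> R}.
Hypotheses (Lu : L2 u) (Lv : L2 v) (Lw : L2 w) (Lux : L2 ux) (Lvx : L2 vx) (Lwx : L2 wx).
(** Integrability at a fixed time is read off the convergence lemmas for constant families; the
    filter is an arbitrary choice. *)
Let cst_cvg f (Lf : L2 f) := @L2cvg_cst R R (nbhs (0 : R)) _ f Lf.

Lemma flA_intg : intg (flA v w ux).
Proof. by have [] := flA_cvg (cst_cvg Lv) (cst_cvg Lw) (cst_cvg Lux). Qed.

Lemma flB_intg : intg (flB u).
Proof. by have [] := flB_cvg (cst_cvg Lu). Qed.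

Lemma flC_intg : intg (flC u v w ux vx wx).
Proof.
by have [] := flC_cvg (cst_cvg Lu) (cst_cvg Lv) (cst_cvg Lw) (cst_cvg Lux) (cst_cvg Lvx) (cst_cvg Lwx).
Qed.

End FluxIntegrable.

(** * Product test functions and the evolution of the mass *)

Lemma intg_test f psi : intg f -> test1 psi -> intg (fun x => f x * psi x).
Proof.
move=> fi tp; have [M _ pM] := test1_bounded tp.
by apply: intgM fi _ pM; exact: test1_meas.
Qed.

Lemma dt_prod theta psi : smooth1 theta ->
  dt (fun t x => theta t * psi x) = fun t x => dd theta t * psi x.
Proof.
move=> st; apply/funext => t; apply/funext => x; rewrite /dt.
have H := has_derivZ (psi x) (smooth1_has_deriv st).
under eq_fun do rewrite mulrC.
by rewrite (has_deriv_derive1 H) mulrC.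
Qed.

Lemma dx_prod theta psi : smooth1 psi ->
  dx (fun t x => theta t * psi x) = fun t x => theta t * dd psi x.
Proof.
move=> st; apply/funext => t; apply/funext => x; rewrite /dx.
by rewrite (has_deriv_derive1 (has_derivZ (theta t) (smooth1_has_deriv st))).
Qed.

Lemma test2_prod theta psi a c : 0 < a -> test1 theta -> test1 psi ->
  (forall t, ~~ (a <= t <= c) -> theta t = 0) ->
  test2 (fun t x => theta t * psi x).
Proof.
move=> a0 tt tp th0; split; last first.
  have [_ [X pX]] := tp; exists a, c, X; split => // t x H.
  have [tac|/th0 ->] := boolP (a <= t <= c); last by rewrite mul0r.
  case/andP: tac => t1 t2; case: H => [|[|/pX ->]]; rewrite ?mulr0//; lra.
move=> l.
have [th [ps [sth sps ->]]] : exists th ps, [/\ smooth1 th, smooth1 ps &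
    Dw l (fun t x => theta t * psi x) = fun t x => th t * ps x].
  elim: l => [|b l [th [ps [sth sps IH]]]]; first by exists theta, psi; split; [exact: tt.1|exact: tp.1|].
  rewrite /= IH; case: b.
    exists (dd th), ps.
    by split; [exact: smooth1_derive1 sth|exact: sps|exact: dt_prod _ sth].
  exists th, (dd ps).
  by split; [exact: sth|exact: smooth1_derive1 sps|exact: dx_prod _ sps].
split.
  move=> p; apply: cvgM.
    apply: (@continuous_comp _ _ _ (fun p : R * R => p.1) th); first exact: cvg_fst.
    exact: smooth1_cont.
  apply: (@continuous_comp _ _ _ (fun p : R * R => p.2) ps); first exact: cvg_snd.
  exact: smooth1_cont.
move=> t x; split; last by have [] := has_derivZ (th t) (smooth1_has_deriv sps) x.
have [H _] := has_derivZ (ps x) (smooth1_has_deriv sth) t; move: H.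
by under eq_fun do rewrite mulrC.
Qed.

Lemma supp_intg f g a c : 0 < a -> test1 f -> (forall t, ~~ (a <= t <= c) -> f t = 0) ->
  (forall t, 0 < t -> {for t, continuous g}) -> intg (fun t => f t * g t).
Proof.
move=> a0 tf f0 cg; apply: (@cont_cpt_intg _ _ a c); last by move=> t /f0 ->; rewrite mul0r.
apply: cont_mul_supp f0 _; first exact: test1_cont.
by move=> t /andP[at_ _]; apply: cg; exact: lt_le_trans a0 at_.
Qed.

Lemma nonneg_measurable : measurable [set t : R | 0 <= t].
Proof. by rewrite -set_itvcy; exact: measurable_itv. Qed.

Lemma pairing_prod (G : R -> R -> R) theta psi :
  (forall t, 0 <= t -> intg (fun x => G t x * psi x)) ->
  (forall t, t < 0 -> theta t = 0) ->
  pairing G (fun t x => theta t * psi x) =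
  \int[mu]_t (theta t * \int[mu]_x (G t x * psi x)).
Proof.
move=> iG th0; rewrite /pairing -(Rint_supp nonneg_measurable).
  apply: eq_Rintegral => t; rewrite inE/= => t0.
  rewrite -RintZl; last exact: iG.
  by apply: Rint_eq => x; rewrite mulrCA.
by move=> t /= /negP; rewrite -ltNge => /th0 ->; rewrite mul0r.
Qed.

Section Evolution.
Context {u v w ux vx wx : R -> R -> R}.
Hypotheses (Hu : C_H1 u ux) (Hv : C_H1 v vx) (Hw : C_H1 w wx).

Let L2s t : 0 <= t -> [/\ L2 (u t), L2 (v t), L2 (w t) & [/\ L2 (ux t), L2 (vx t) & L2 (wx t)]].
Proof.
move=> t0; have [Lu [Lux _]] := Hu.1 t t0; have [Lv [Lvx _]] := Hv.1 t t0.
by have [Lw [Lwx _]] := Hw.1 t t0; split.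
Qed.

Lemma mass_continuous psi t : 0 < t -> L2 psi ->
  {for t, continuous (fun s => \int[mu]_x (u s x * psi x))}.
Proof.
move=> t0 Lp; have [c _] := C_H1_L2cvg Hu t0.
exact: (L2cvgM c (L2cvg_cst Lp)).
Qed.

Let fluxcvg t psi : 0 < t -> test1 psi ->
  [/\ {for t, continuous (fun s => \int[mu]_x (flA (v s) (w s) (ux s) x * psi x))},
      {for t, continuous (fun s => \int[mu]_x (flB (u s) x * psi x))} &
      {for t, continuous (fun s => \int[mu]_x (flC (u s) (v s) (w s) (ux s) (vx s) (wx s) x * psi x))}].
Proof.
move=> t0 tp; have [M _ pM] := test1_bounded tp; have mp := test1_meas tp.
have [c1 d1] := C_H1_L2cvg Hu t0; have [c2 d2] := C_H1_L2cvg Hv t0.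
have [c3 d3] := C_H1_L2cvg Hw t0; split.
- by have [_ _] := flA_cvg c2 c3 d1; apply; [exact: mp|exact: pM].
- by have [_ _] := flB_cvg c1; apply; [exact: mp|exact: pM].
- by have [_ _] := flC_cvg c1 c2 c3 d1 d2 d3; apply; [exact: mp|exact: pM].
Qed.

Lemma flux_continuous psi t : 0 < t -> test1 psi ->
  {for t, continuous (fun s => flux (u s) (v s) (w s) (ux s) (vx s) (wx s) psi)}.
Proof.
move=> t0 tp; have tp1 := test1_derive1 tp; have tp2 := test1_derive1 tp1.
have tp3 := test1_derive1 tp2.
have [_ _ c3] := fluxcvg t0 tp1; have [c1 _ _] := fluxcvg t0 tp2.
have [_ c2 _] := fluxcvg t0 tp3.
by apply: cvgD c3; apply: cvgB c1 _; exact: cvgMr c2.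
Qed.

(** Each pairing factors into a time integral of a spatial integral. The time integrands are
    continuous and supported in [a <= t <= c], hence integrable, so the four integrals merge into
    one. *)
Lemma weak_eq_prod theta psi a c : 0 < a -> test1 theta -> test1 psi ->
  (forall t, ~~ (a <= t <= c) -> theta t = 0) ->
  weak_eq u v w ux vx wx (fun t x => theta t * psi x) ->
  \int[mu]_t (dd theta t * (\int[mu]_x (u t x * (psi x - dd (dd psi) x)))
    + theta t * flux (u t) (v t) (w t) (ux t) (vx t) (wx t) psi) = 0.
Proof.
move=> a0 tt tp th0.
have tp1 := test1_derive1 tp; have tp2 := test1_derive1 tp1; have tp3 := test1_derive1 tp2.
have th1 := derive1_supp th0.
have Lchi : L2 (fun x => psi x - dd (dd psi) x) by apply: L2B; exact: test1_L2.
have n0 t : t < 0 -> theta t = 0.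
  by move=> t0; apply: th0; rewrite negb_and -ltNge (lt_trans t0 a0).
have n1 t : t < 0 -> dd theta t = 0.
  by move=> t0; apply: th1; rewrite negb_and -ltNge (lt_trans t0 a0).
rewrite /weak_eq dt_prod ?(dx_prod _ tp.1) ?(dx_prod _ tp1.1) ?(dx_prod _ tp2.1); last exact: tt.1.
have -> : (fun t x => dd theta t * psi x - dd theta t * dd (dd psi) x) =
    fun t x => dd theta t * (psi x - dd (dd psi) x).
  by apply/funext => t; apply/funext => x; rewrite mulrBr.
rewrite (@pairing_prod u)//; last by move=> t /L2s[Lu _ _ _]; exact: L2M_intg.
rewrite (@pairing_prod (fun t => flA (v t) (w t) (ux t)))//; last first.
  by move=> t /L2s[Lu Lv Lw [Lux Lvx Lwx]]; apply: intg_test => //; exact: flA_intg.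
rewrite (@pairing_prod (fun t => flB (u t)))//; last first.
  by move=> t /L2s[Lu Lv Lw [Lux Lvx Lwx]]; apply: intg_test => //; exact: flB_intg.
rewrite (@pairing_prod (fun t => flC (u t) (v t) (w t) (ux t) (vx t) (wx t)))//; last first.
  by move=> t /L2s[Lu Lv Lw [Lux Lvx Lwx]]; apply: intg_test => //; exact: flC_intg.
have tt1 := test1_derive1 tt.
have i1 : intg (fun t => dd theta t * \int[mu]_x (u t x * (psi x - dd (dd psi) x))).
  by apply: (supp_intg a0 tt1 th1) => t t0; exact: mass_continuous.
have i2 : intg (fun t => theta t * \int[mu]_x (flA (v t) (w t) (ux t) x * dd (dd psi) x)).
  by apply: (supp_intg a0 tt th0) => t t0; have [] := fluxcvg t0 tp2.
have i3 : intg (fun t => theta t * \int[mu]_x (flB (u t) x * dd (dd (dd psi)) x)).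
  by apply: (supp_intg a0 tt th0) => t t0; have [] := fluxcvg t0 tp3.
have i4 : intg (fun t => theta t * \int[mu]_x (flC (u t) (v t) (w t) (ux t) (vx t) (wx t) x * dd psi x)).
  by apply: (supp_intg a0 tt th0) => t t0; have [] := fluxcvg t0 tp1.
have i12 := intgD i1 i2; have i123 := intgB i12 (intgZl 2^-1 i3).
rewrite -(RintD i1 i2) -(RintZl _ i3) -(RintB i12 (intgZl 2^-1 i3)) -(RintD i123 i4).
move=> E; apply: etrans E; apply: Rint_eq => t.
by rewrite /flux mulrDr mulrBr (mulrCA (theta t) 2^-1) !addrA.
Qed.

End Evolution.

(** * Reflection of test functions and parity of the flux *)

Lemma Rint_refl_sym f psi sg a : measurable_fun setT f -> test1 psi ->
  intg (fun x => f x * psi x) -> {ae mu, forall x, f x = sg * f (a - x)} ->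
  \int[mu]_x (f x * psi (a - x)) = sg * \int[mu]_x (f x * psi x).
Proof.
move=> mf tp ifp fa; have mp := test1_meas tp.
rewrite (@Rint_ae _ _ (fun x => sg * (f (a - x) * psi (a - x)))).
- rewrite RintZl; last exact: (intg_refl a ifp).
  by rewrite (Rint_refl a ifp).
- by apply: measurable_funM => //; exact: meas_comp_refl.
- by apply: measurable_funM => //; apply: measurable_funM; exact: meas_comp_refl.
- by apply: ae_mono fa _ => x {1}->; rewrite mulrA.
Qed.

Lemma Rint_refl_symN f psi sg a : intg f -> test1 psi ->
  {ae mu, forall x, f x = sg * f (a - x)} ->
  \int[mu]_x (f x * - psi (a - x)) = - (sg * \int[mu]_x (f x * psi x)).
Proof.
move=> fi tp fa.
rewrite -(Rint_refl_sym (intg_meas fi) tp (intg_test fi tp) fa) -mulN1r -RintZl.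
  by apply: Rint_eq => x; rewrite mulrN mulN1r.
exact: (intg_test fi (test1_refl a tp)).
Qed.

Lemma H1_even_deriv_odd f g a : H1 f g -> {ae mu, forall x, f x = f (a - x)} ->
  {ae mu, forall x, g x = - g (a - x)}.
Proof.
move=> [Lf [Lg H]] fa.
have Lg' : L2 (fun x => - g (a - x)).
  by have := L2Zl (-1) (L2_refl a Lg); under eq_fun do rewrite mulN1r.
apply: (weak_deriv_unique H _ Lg Lg') => phi tphi.
rewrite -(weak_deriv_refl a Lf Lg H tphi).
have md := test1_meas (test1_derive1 tphi).
apply: Rint_ae.
- by apply: measurable_funM => //; exact: L2_meas.
- by apply: measurable_funM => //; apply: meas_comp_refl; exact: L2_meas.
- by apply: ae_mono fa _ => x {1}->.
Qed.

Lemma L2cvg_comp {T U : Type} (F : set_system T) (G : set_system U) {FF : Filter F}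
    (k : U -> R -> R) f (h : T -> U) :
  L2cvg G k f -> h @ F --> G -> L2cvg F (fun s => k (h s)) f.
Proof.
move=> [Lk Lf ck] hF; split => //; first exact: (hF _ Lk).
exact: (cvg_comp _ _ hF ck).
Qed.

Lemma L2cvg_refl {T : Type} (F : set_system T) {FF : Filter F} (k : T -> R -> R) f a :
  L2cvg F k f -> L2cvg F (fun s x => k s (a - x)) (fun x => f (a - x)).
Proof.
move=> [Lk Lf ck].
apply: (@L2cvg_intro _ _ _ _ _ _ (fun s => \int[mu]_x (k s x - f x) ^+ 2)) => //.
- by near=> s; apply: L2_refl; near: s.
- exact: L2_refl.
- near=> s; have Lks : L2 (k s) by near: s.
  by rewrite (Rint_refl a (L2_sqr (L2B Lks Lf))).
Unshelve. all: by end_near. Qed.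

Lemma refl_derive1 psi a : smooth1 psi ->
  dd (fun x => psi (a - x)) = fun x => - dd psi (a - x).
Proof. by move=> sp; exact: (has_deriv_derive1 (has_deriv_refl a (smooth1_has_deriv sp))). Qed.

Lemma oppr_derive1 psi : smooth1 psi -> dd (fun x => - psi x) = fun x => - dd psi x.
Proof.
move=> sp; have := has_deriv_derive1 (has_derivZ (-1) (smooth1_has_deriv sp)).
by under eq_fun do rewrite mulN1r; under [in X in _ = X]eq_fun do rewrite mulN1r.
Qed.

Lemma refl_derive2 psi a : smooth1 psi ->
  dd (dd (fun x => psi (a - x))) = fun x => dd (dd psi) (a - x).
Proof.
move=> sp; have sp1 := smooth1_derive1 sp; rewrite (refl_derive1 a sp).
apply: etrans (oppr_derive1 (@smooth1_refl _ a _ sp1)) _.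
by rewrite (refl_derive1 a sp1); apply/funext => x; rewrite opprK.
Qed.

Lemma refl_derive3 psi a : smooth1 psi ->
  dd (dd (dd (fun x => psi (a - x)))) = fun x => - dd (dd (dd psi)) (a - x).
Proof.
move=> sp; rewrite (refl_derive2 a sp).
exact: (refl_derive1 a (smooth1_derive1 (smooth1_derive1 sp))).
Qed.

(** Every term changes sign: [flA] is odd and meets the second derivative, which reflects without a
    sign; [flB] and [flC] are even and meet derivatives of odd order, which reflect with one. *)
Lemma flux_refl u v w ux vx wx psi a :
  H1 u ux -> H1 v vx -> H1 w wx -> test1 psi ->
  {ae mu, forall x, u x = u (a - x) /\ v x = v (a - x) /\ w x = w (a - x)} ->
  flux u v w ux vx wx (fun x => psi (a - x)) = - flux u v w ux vx wx psi.
Proof.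
move=> Hu Hv Hw tp sym.
have tp1 := test1_derive1 tp; have tp2 := test1_derive1 tp1; have tp3 := test1_derive1 tp2.
have [Lu [Lux _]] := Hu; have [Lv [Lvx _]] := Hv; have [Lw [Lwx _]] := Hw.
have su : {ae mu, forall x, u x = u (a - x)} by apply: ae_mono sym _ => x [].
have sv : {ae mu, forall x, v x = v (a - x)} by apply: ae_mono sym _ => x [? []].
have sw : {ae mu, forall x, w x = w (a - x)} by apply: ae_mono sym _ => x [? []].
have sux := H1_even_deriv_odd Hu su; have svx := H1_even_deriv_odd Hv sv.
have swx := H1_even_deriv_odd Hw sw.
have S := ae_and (ae_and su (ae_and sv sw)) (ae_and sux (ae_and svx swx)).
have sA : {ae mu, forall x, flA v w ux x = -1 * flA v w ux (a - x)}.
  by apply: ae_mono S _ => x [[? [? ?]] [? [? ?]]]; rewrite /flA; nra.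
have sB : {ae mu, forall x, flB u x = 1 * flB u (a - x)}.
  by apply: ae_mono S _ => x [[? [? ?]] [? [? ?]]]; rewrite /flB; nra.
have sC : {ae mu, forall x, flC u v w ux vx wx x = 1 * flC u v w ux vx wx (a - x)}.
  by apply: ae_mono S _ => x [[? [? ?]] [? [? ?]]]; rewrite /flC; nra.
have iA := flA_intg Lv Lw Lux; have iB := flB_intg Lu.
have iC := flC_intg Lu Lv Lw Lux Lvx Lwx.
apply: etrans (fluxE _ _ _ _ _ _ (refl_derive1 a tp.1) (refl_derive2 a tp.1) (refl_derive3 a tp.1)) _.
have E1 := Rint_refl_sym (intg_meas iA) tp2 (intg_test iA tp2) sA.
have E2 := Rint_refl_symN iB tp3 sB; have E3 := Rint_refl_symN iC tp1 sC.
have alg (x y z : R) : -1 * x - 2^-1 * - (1 * y) + - (1 * z) = - (x - 2^-1 * y + z) by ring.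
by rewrite E1 E2 E3; exact: alg.
Qed.

End FluxIdentity.

(** * Compactly supported functions of two variables *)

Section TwoVariables.
Context {R : realType}.
Notation mu := (@lebesgue_measure R).
Implicit Types (f : R -> R -> R) (F : R -> R) (c t x y s : R).

Lemma cont2_delta f t x e : continuous (fun p : R * R => f p.1 p.2) -> 0 < e ->
  exists2 del, 0 < del & forall s y, `|s - t| < del -> `|y - x| < del ->
    `|f s y - f t x| < e.
Proof.
move=> cf e0; have /cvgrPdist_lt/(_ _ e0) := cf (t, x).
move=> /nbhs_ballP[del /= del0 H]; exists del => // s y st yx.
have := H (s, y); rewrite /= distrC; apply.
by split; rewrite /ball/= distrC.
Qed.

(** The second difference of [f] over a square of side [h] equals [h^2] times either mixed
    derivative at some nearby point, by the mean value theorem used twice in each order. Continuity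
    then brings both points back to [(t, x)]. *)
Lemma schwarz f f_t f_x f_tx f_xt :
  (forall x, has_deriv (f ^~ x) (f_t ^~ x)) -> (forall t, has_deriv (f t) (f_x t)) ->
  (forall t, has_deriv (f_t t) (f_tx t)) -> (forall x, has_deriv (f_x ^~ x) (f_xt ^~ x)) ->
  continuous (fun p : R * R => f_tx p.1 p.2) ->
  continuous (fun p : R * R => f_xt p.1 p.2) ->
  f_tx = f_xt.
Proof.
move=> Ht Hx Htx Hxt c1 c2; apply/funext => t; apply/funext => x.
apply/eqP; rewrite -subr_eq0 -normr_le0; apply/ler_addgt0Pr => e e0.
have e2 : 0 < e / 2 by rewrite divr_gt0.
have [d1 d10 H1] := cont2_delta t x c1 e2; have [d2 d20 H2] := cont2_delta t x c2 e2.
pose h := Num.min d1 d2 / 2.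
have m0 : 0 < Num.min d1 d2 by rewrite lt_min d10.
have m1 : Num.min d1 d2 <= d1 by rewrite ge_min lexx.
have m2 : Num.min d1 d2 <= d2 by rewrite ge_min lexx orbT.
have h0 : 0 < h by rewrite /h divr_gt0.
have hE : `|h| = h by rewrite gtr0_norm.
have hd1 : h < d1 by rewrite /h; lra.
have hd2 : h < d2 by rewrite /h; lra.
have [a1 a1t E1] := @mvt R _ _ t h (has_derivB (Ht (x + h)) (Ht x)).
have [b1 b1x E2] := @mvt R _ _ x h (Htx a1).
have [b2 b2x E3] := @mvt R _ _ x h (has_derivB (Hx (t + h)) (Hx t)).
have [a2 a2t E4] := @mvt R _ _ t h (Hxt b2).
rewrite /= E2 in E1; rewrite /= E4 in E3.
have E : f_tx a1 b1 = f_xt a2 b2.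
  apply: (mulfI (lt0r_neq0 h0)); apply: (mulfI (lt0r_neq0 h0)).
  by rewrite -E1 -E3; ring.
have K1 := H1 a1 b1; have K2 := H2 a2 b2; rewrite hE in a1t b1x a2t b2x.
have {}K1 := K1 (le_lt_trans a1t hd1) (le_lt_trans b1x hd1).
have {}K2 := K2 (le_lt_trans a2t hd2) (le_lt_trans b2x hd2).
rewrite add0r; apply: ltW; rewrite E in K1.
have -> : f_tx t x - f_xt t x = - (f_xt a2 b2 - f_tx t x) + (f_xt a2 b2 - f_xt t x) by ring.
by rewrite (le_lt_trans (ler_normD _ _))// normrN; lra.
Qed.

(** The increment is split into a step in space at the fixed time [t], which uses [f_x] at one
    point, and a step in time at a moving position, where the mean value theorem and continuity of
    [f_t] give the limit. Continuity of [f_x] does not enter. *)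
Lemma has_deriv_along f f_t f_x c t0 y :
  (forall x, has_deriv (f ^~ x) (f_t ^~ x)) -> (forall t, has_deriv (f t) (f_x t)) ->
  continuous (fun p : R * R => f_t p.1 p.2) ->
  has_deriv (fun t => f t (y + c * (t - t0)))
       (fun t => f_t t (y + c * (t - t0)) + c * f_x t (y + c * (t - t0))).
Proof.
move=> Ht Hx ct t.
pose z := y + c * (t - t0).
have shiftc : (c * k) @[k --> (0 : R)] --> (0 : R).
  by rewrite -[X in _ --> X](mulr0 c); apply: cvgMr; exact: cvg_id.
have L2' : k^-1 * (f t (z + c * k) - f t z) @[k --> (0 : R)^'] --> c * f_x t z.
  have H := has_deriv_aff c z (Hx t) 0; rewrite mulr0 add0r in H.
  have [/cvg_ex[l Hl] El] := H.
  have <- : l = c * f_x t z.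
    by rewrite -El /derive; apply/esym; exact: cvg_lim Hl.
  move: Hl; rewrite /= mulr0 add0r; apply: cvg_trans; apply: near_eq_cvg; near=> k.
  by rewrite /GRing.scale/= mulr1 addr0 [c * k + z]addrC.
have L1' : k^-1 * (f (t + k) (z + c * k) - f t (z + c * k)) @[k --> (0 : R)^'] --> f_t t z.
  apply/cvgrPdist_lt => e e0.
  have [del del0 H] := cont2_delta t z ct e0.
  near=> k.
  have k0 : k != 0 by near: k; exact: nbhs_dnbhs_neq.
  have kd : `|k| < del.
    by near: k; apply: (@cvg_within _ (nbhs (0 : R))); exact: near0_norm.
  have ckd : `|c * k| < del.
    near: k; apply: (@cvg_within _ (nbhs (0 : R))).
    by have := cvgr_lt _ (cvg_norm shiftc); rewrite normr0; exact.
  have [xi xit ->] := mvt t k (Ht (z + c * k)).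
  rewrite mulKf// distrC; apply: H; first exact: le_lt_trans xit kd.
  by rewrite addrC addKr.
have L : k^-1 *: ((f (k *: (1 : R) + t) (y + c * (k *: (1 : R) + t - t0)) : R^o) - f t z)
    @[k --> (0 : R)^'] --> f_t t z + c * f_x t z.
  apply: cvg_trans (cvgD L1' L2'); apply: near_eq_cvg; near=> k.
  rewrite /GRing.scale/= mulr1 -mulrDr /z (addrC k t).
  have -> : y + c * (t + k - t0) = y + c * (t - t0) + c * k by ring.
  by rewrite addrA subrK.
split; first by apply/cvg_ex; exists (f_t t z + c * f_x t z).
exact: cvg_lim L.
Unshelve. all: by end_near. Qed.

(* The supports stay away from [t = 0], as for test functions on the open half
   plane; hence integrating a time derivative over [0 <= t] gives [0]. *)
Definition ccont2 f := continuous (fun p : R * R => f p.1 p.2) /\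
  exists T1 T2 X, 0 < T1 /\ forall t x, (t < T1 \/ T2 < t \/ X < `|x|) -> f t x = 0.

Lemma ccont2_shift c t0 f : ccont2 f -> ccont2 (fun t x => f t (x + c * (t - t0))).
Proof.
move=> [cf [T1 [T2 [X [T10 f0]]]]]; split.
  move=> p; apply: (@continuous_comp _ _ _ (fun p : R * R => (p.1, p.2 + c * (p.1 - t0)))
    (fun p : R * R => f p.1 p.2)); last exact: cf.
  have H1 : (x.1 : R) @[x --> p] --> p.1 by exact: cvg_fst.
  have H2 : (x.2 + c * (x.1 - t0)) @[x --> p] --> p.2 + c * (p.1 - t0).
    apply: cvgD; first exact: cvg_snd.
    by apply: cvgMr; apply: cvgB; [exact: H1|exact: cvg_cst].
  exact: (cvg_pair H1 H2).
(* Between the times [T1] and [T2] the displacement [c * (t - t0)] is at most the quantity added to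
   [X]. *)
exists T1, T2, (X + `|c| * (`|T1| + `|T2| + `|t0|)); split => // t x H.
apply: f0; have [tT1|tT1] := ltP t T1; [by left|right].
have [tT2|tT2] := ltP T2 t; [by left|right].
case: H => [|[|]]; [lra|lra|move=> xX].
have : `|c * (t - t0)| <= `|c| * (`|T1| + `|T2| + `|t0|).
  rewrite normrM ler_wpM2l// (le_trans (ler_normB _ _))// lerD2r.
  rewrite ler_norml; have := ler_norm T1; have := lerNnormlW (lexx `|T1|).
  by have := ler_norm T2; have := normr_ge0 T1; have := normr_ge0 T2; lra.
have := lerB_normD x (c * (t - t0)); lra.
Qed.

Lemma ccont2_bounded f : ccont2 f -> exists M X, [/\ 0 <= M, 0 <= X &
  forall t x, `|f t x| <= M * \1_(`[- X, X]%classic : set R) x].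
Proof.
move=> [cf [T1 [T2 [X [T10 f0]]]]].
pose K : set (R * R) := `[T1, T2]%classic `*` `[- X, X]%classic.
have cK : compact K by apply: compact_setX; exact: segment_compact.
have [M [_ MP]] : bounded_set ((fun p : R * R => f p.1 p.2) @` K).
  by apply/compact_bounded/continuous_compact => //; exact: continuous_subspaceT.
exists (`|M| + 1), `|X|; split => // t x; rewrite indicE.
have [xX|xX] := leP `|x| X; last first.
  by rewrite f0 ?normr0; [rewrite mulr_ge0|right; right].
rewrite mem_set/= ?in_itv/= ?mulr1; last first.
  by rewrite -ler_norml (le_trans xX)// ler_norm.
have [tT1|tT1] := ltP t T1; first by rewrite f0 ?normr0//; left.
have [tT2|tT2] := ltP T2 t; first by rewrite f0 ?normr0//; right; left.
apply: (MP (`|M| + 1)); first by rewrite ltr_pwDr// ler_norm.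
exists (t, x) => //; split; rewrite /= in_itv/=; first by rewrite tT1.
by rewrite -ler_norml.
Qed.

(** Common ground for the profile, which is in L2, and the flux coefficients, which are in L1: both
    are integrated against functions with bounded support. *)
Definition locint F := measurable_fun setT F /\
  forall X, intg (fun x => F x * \1_(`[- X, X]%classic : set R) x).

Lemma intg_locint F : intg F -> locint F.
Proof.
move=> iF; split; first exact: intg_meas.
move=> X; apply: (@intgM _ _ _ 1) => //.
by move=> x; rewrite indicE; case: (_ \in _); rewrite ?normr1 ?normr0.
Qed.

Lemma L2_locint F : L2 F -> locint F.
Proof.
move=> iF; split; first exact: L2_meas.
by move=> X; apply: L2M_intg => //; apply: indic_L2; [exact: measurable_itv|exact: itv_fin].
Qed.

Lemma ccont2_cont_snd f t : ccont2 f -> continuous (f t).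
Proof.
move=> [cf _] x; apply: (@continuous_comp _ _ _ (fun x => (t, x))
    (fun p : R * R => f p.1 p.2)); last exact: cf.
have H1 : t @[_ --> x] --> t by exact: cvg_cst.
exact: (cvg_pair H1 (@cvg_id _ (nbhs x))).
Qed.

Lemma ccont2_cont_fst f x : ccont2 f -> continuous (f ^~ x).
Proof.
move=> [cf _] t; apply: (@continuous_comp _ _ _ (fun t => (t, x))
    (fun p : R * R => f p.1 p.2)); last exact: cf.
have H1 : x @[_ --> t] --> x by exact: cvg_cst.
exact: (cvg_pair (@cvg_id _ (nbhs t)) H1).
Qed.

Lemma ccont2_dominated F f : locint F -> ccont2 f -> exists2 g,
  intg g & forall t x, `|F x * f t x| <= g x.
Proof.
move=> [mF iF] cf; have [M [X [M0 X0 fM]]] := ccont2_bounded cf.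
exists (fun x => M * `|F x * \1_(`[- X, X]%classic : set R) x|).
  by apply: intgZl; exact: intg_norm.
move=> t x; rewrite !normrM mulrCA ler_wpM2l// (le_trans (fM t x))//.
by rewrite ler_wpM2l// ler_norm.
Qed.

Lemma ccont2_intg F f t : locint F -> ccont2 f -> intg (fun x => F x * f t x).
Proof.
move=> lF cf; have [g ig fg] := ccont2_dominated lF cf.
apply: (le_intg _ (fg t) ig).
by apply: measurable_funM; [exact: lF.1|apply: cont_meas; exact: ccont2_cont_snd].
Qed.

Lemma ccont2_int_cont F f : locint F -> ccont2 f ->
  continuous (fun t => \int[mu]_x (F x * f t x)).
Proof.
move=> lF cf t; have [g ig fg] := ccont2_dominated lF cf.
have := @continuity_under_integral R _ _ mu (fun t x => F x * f t x) setT measurableT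
  (t - 1) (t + 1) _ _ g ig _ t; apply.
- by move=> s _; exact: ccont2_intg.
- by apply: aeW => x _ s _; apply: cvgMr; have := @ccont2_cont_fst f x cf s.
- by move=> s _; apply: aeW => x _; exact: fg.
- by rewrite inE/= in_itv/=; apply/andP; split; lra.
Qed.

Lemma ccont2_int_has_deriv F f f_t : locint F -> ccont2 f -> ccont2 f_t ->
  (forall x, has_deriv (f ^~ x) (f_t ^~ x)) ->
  has_deriv (fun t => \int[mu]_x (F x * f t x)) (fun t => \int[mu]_x (F x * f_t t x)).
Proof.
move=> lF cf cft Hd t; have [g ig fg] := ccont2_dominated lF cft.
have d1E s x : partial1of2 (fun t x => F x * f t x) s x = F x * f_t s x.
  by rewrite /partial1of2 (has_deriv_derive1 (has_derivZ (F x) (Hd x))).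
have It : (`]t - 1, t + 1[%classic : set R) t by rewrite /= in_itv/=; apply/andP; split; lra.
have H1 : forall s, (`]t - 1, t + 1[%classic : set R) s -> intg (fun x => F x * f s x).
  by move=> s _; exact: ccont2_intg.
have H2 : forall s y, (`]t - 1, t + 1[%classic : set R) s -> setT y ->
    derivable ((fun t x => F x * f t x) ^~ y : R -> R^o) s 1.
  by move=> s y _ _; have [] := has_derivZ (F y) (Hd y) s.
have g0 y : 0 <= g y by exact: le_trans (fg t y).
have H3 : forall s y, (`]t - 1, t + 1[%classic : set R) s -> setT y ->
    `|partial1of2 (fun t x => F x * f t x) s y| <= g y.
  by move=> s y _ _; rewrite d1E.
have := @cvg_differentiation_under_integral R _ _ mu (fun t x => F x * f t x) setT measurableT
  t (t - 1) (t + 1) It H1 H2 g g0 ig H3.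
have E : \int[mu]_x partial1of2 (fun t x => F x * f t x) t x = \int[mu]_x (F x * f_t t x).
  by apply: Rint_eq => x; exact: d1E.
rewrite E => H.
have L : k^-1 *: ((\int[mu]_x (F x * f (k *: (1 : R) + t) x) : R^o) - \int[mu]_x (F x * f t x))
    @[k --> (0 : R)^'] --> \int[mu]_x (F x * f_t t x).
  apply: cvg_trans H; apply: near_eq_cvg; near=> k.
  by rewrite /GRing.scale/= mulr1.
split; first by apply/cvg_ex; exists (\int[mu]_x (F x * f_t t x)).
exact: cvg_lim L.
Unshelve. all: by end_near. Qed.

Lemma ccont2_int_zero F f : ccont2 f -> exists2 Y, 0 < Y &
  (forall t, t < Y^-1 \/ Y < t -> \int[mu]_x (F x * f t x) = 0).
Proof.
move=> [_ [T1 [T2 [X [T10 f0]]]]].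
(* One number bounds the support at both ends: its inverse is at most [T1], and it is at least
   [T2]. *)
exists (`|T2| + T1^-1); first by rewrite ltr_wpDl// invr_gt0.
move=> t H; have {}H : t < T1 \/ T2 < t.
  case: H => H; [left|right].
    apply: lt_le_trans H _; rewrite -[leRHS]invrK lef_pV2 ?posrE ?invr_gt0 ?ltr_wpDl ?invr_gt0//.
    by rewrite lerDr.
  by have := ler_norm T2; have : 0 < T1^-1 by [rewrite invr_gt0]; lra.
transitivity (\int[mu]_(x in [set: R]) (0 : R)); last by rewrite Rintegral_cst// mul0r.
by apply: Rint_eq => x; rewrite f0 ?mulr0//; case: H => ?; [left|right; left].
Qed.

Lemma ccont2_time_int F f f_t : locint F -> ccont2 f -> ccont2 f_t ->
  (forall x, has_deriv (f ^~ x) (f_t ^~ x)) ->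
  \int[mu]_(t in [set t | 0 <= t]) (\int[mu]_x (F x * f_t t x)) = 0.
Proof.
move=> lF cf cft Hd.
have [Y Y0 Z] := ccont2_int_zero F cf; have [Y1 Y10 Z1] := ccont2_int_zero F cft.
have m0 : measurable [set t : R | 0 <= t] by rewrite -set_itvcy; exact: measurable_itv.
rewrite Rint_supp//.
  apply: (@int_deriv_cpt _ (fun t => \int[mu]_x (F x * f t x)) _ Y).
  - exact: ccont2_int_has_deriv.
  - exact: ccont2_int_cont.
  - move=> t; rewrite negb_and -!ltNge => tY; apply: Z.
    by case/orP: tY => ?; [left|right] => //; have : 0 < Y^-1 by [rewrite invr_gt0]; lra.
move=> t /= /negP; rewrite -ltNge => t0; apply: Z1; left.
by have : 0 < Y1^-1 by [rewrite invr_gt0]; lra.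
Qed.

Lemma ccont2_time_intg F f : locint F -> ccont2 f ->
  mu.-integrable [set t | 0 <= t] (EFin \o (fun t => \int[mu]_x (F x * f t x))).
Proof.
move=> lF cf; have [Y Y0 Z] := ccont2_int_zero F cf.
have m0 : measurable [set t : R | 0 <= t] by rewrite -set_itvcy; exact: measurable_itv.
apply: (@integrableS _ _ _ _ setT) => //.
apply: (@cont_cpt_intg _ _ (- Y) Y); first exact: ccont2_int_cont.
move=> t; rewrite negb_and -!ltNge => tY; apply: Z.
by case/orP: tY => ?; [left|right] => //; have : 0 < Y^-1 by [rewrite invr_gt0]; lra.
Qed.

(** The regions where [f] is known to vanish are given by strict inequalities, hence open, so every
    differentiation preserves the vanishing there. *)
Lemma test2_ccont2 f w : test2 f -> ccont2 (Dw w f).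
Proof.
move=> [sf [T1 [T2 [X [T10 f0]]]]]; split; first by have [] := sf w.
exists T1, T2, X; split => //; elim: w => [|b w IH] //= t x H.
have N1 (a z : R) : a < z -> \forall y \near z, a < y.
  by move=> az; exact: (cvgr_gt z (@cvg_id _ (nbhs z))).
have N2 (a z : R) : z < a -> \forall y \near z, y < a.
  by move=> az; exact: (cvgr_lt z (@cvg_id _ (nbhs z))).
have N3 (z : R) : X < `|z| -> \forall y \near z, X < `|y|.
  by move=> az; exact: (cvgr_gt `|z| (cvg_norm (@cvg_id _ (nbhs z)))).
case: b; rewrite /dt /dx; apply: derive1_local0.
  case: H => [tT|[tT|xX]]; near=> s; apply: IH.
  - by left; near: s; exact: N2.
  - by right; left; near: s; exact: N1.
  - by right; right.
case: H => [tT|[tT|xX]]; near=> s; apply: IH.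
- by left.
- by right; left.
- by right; right; near: s; exact: N3.
Unshelve. all: by end_near. Qed.

Lemma smooth2_has_deriv_t f w x : smooth2 f -> has_deriv (Dw w f ^~ x) (dt (Dw w f) ^~ x).
Proof.
move=> sf; have [_ H] := sf w.
exact: (@derivable_has_deriv _ (fun s => Dw w f s x) (fun t => (H t x).1)).
Qed.

Lemma smooth2_has_deriv_x f w t : smooth2 f -> has_deriv (Dw w f t) (dx (Dw w f) t).
Proof.
move=> sf; have [_ H] := sf w.
exact: (@derivable_has_deriv _ (fun y => Dw w f t y) (fun x => (H t x).2)).
Qed.

(** [smooth2] supplies continuous derivatives along every word in [dt] and [dx] without relating
    different orders; the exchange comes from [schwarz]. *)
Lemma smooth2_comm f w : smooth2 f -> dx (dt (Dw w f)) = dt (dx (Dw w f)).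
Proof.
move=> sf; apply: (@schwarz (Dw w f) (dt (Dw w f)) (dx (Dw w f))).
- by move=> x; exact: smooth2_has_deriv_t.
- by move=> t; exact: smooth2_has_deriv_x.
- by move=> t; exact: (@smooth2_has_deriv_x f (true :: w)).
- by move=> x; exact: (@smooth2_has_deriv_t f (false :: w)).
- by have [] := sf [:: false, true & w].
- by have [] := sf [:: true, false & w].
Qed.

End TwoVariables.

(** * Symmetric solutions *)

Section SymmetricFlux.
Context {R : realType}.
Notation mu := (@lebesgue_measure R).
Notation dd f := (derive1 (f : R -> R^o)).

(** Here [y] stands for the speed, [i] for the pairing with the differentiated test function, and
    [n], [n0] for the fluxes of a test function and of its reflection. *)
Let double_cancel (y i n n0 : R) : 2 * y * i = n - n0 -> n0 = - n -> n = y * i.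
Proof. lra. Qed.

Let half_pos (t0 t : R) : `|t - t0| < t0 / 2 -> 0 < t.
Proof. by rewrite ltr_norml => /andP[]; lra. Qed.

Let half_pos' (t0 rho : R) : 0 < t0 -> rho < t0 / 2 -> 0 < t0 - rho.
Proof. lra. Qed.

Let regroup (y i j z n m : R) : y * (i - j) + z * (n - m) = y * i + z * n - (y * j + z * m).
Proof. by ring. Qed.

Lemma test1B (f g : R -> R) : test1 f -> test1 g -> test1 (fun x => f x - g x).
Proof.
move=> [sf [X fX]] [sg [Y gY]]; split.
  by have := smooth1D sf (@smooth1Z _ (-1) _ sg); under eq_fun do rewrite mulN1r.
exists (Num.max X Y) => x; rewrite gt_max => /andP[xX xY].
by rewrite fX// gY// subrr.
Qed.

Context {u v w ux vx wx : R -> R -> R}.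
Hypotheses (Hu : C_H1 u ux) (Hv : C_H1 v vx) (Hw : C_H1 w wx).
Hypothesis Hweak : forall phi, test2 phi -> weak_eq u v w ux vx wx phi.
Variable b : R -> R.
Hypothesis Cb : C1 b.
Hypothesis sym : forall t, 0 <= t -> {ae mu, forall x,
  u t x = u t (2 * b t - x) /\ v t x = v t (2 * b t - x) /\ w t x = w t (2 * b t - x)}.

Let symu t : 0 <= t -> {ae mu, forall x, u t x = 1 * u t (2 * b t - x)}.
Proof. by move=> t0; apply: ae_mono (sym t0) _ => x [? _]; rewrite mul1r. Qed.

Let Lu t : 0 <= t -> L2 (u t). Proof. by move=> /(Hu.1)[]. Qed.

Let mass_refl t chi : 0 <= t -> test1 chi ->
  \int[mu]_x (u t x * chi (2 * b t - x)) = \int[mu]_x (u t x * chi x).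
Proof.
move=> t0 tc.
rewrite (Rint_refl_sym (L2_meas (Lu t0)) tc _ (symu t0)) ?mul1r//.
by apply: L2M_intg; [exact: Lu|exact: test1_L2].
Qed.

Let C1_lim t0 : k^-1 * (b (t0 + k) - b t0) @[k --> (0 : R)^'] --> dd b t0.
Proof.
have [/cvg_ex[l Hl] El] := derivable_has_deriv Cb.1 t0.
have <- : l = dd b t0 by rewrite -El /derive; apply/esym; exact: cvg_lim Hl.
apply: cvg_trans Hl; apply: near_eq_cvg; near=> k.
by rewrite /GRing.scale/= mulr1 (addrC k).
Unshelve. all: by end_near. Qed.

(** Symmetry at time [t] replaces [chi x] by [chi (2 * b t - x)] in the first integral, so the
    increment falls on [chi] alone and [d t = h t * J t]. The factor [J t] pairs [u t] with a
    difference quotient of [chi] and converges because both converge strongly in L2; [h] is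
    differentiated through [b]. *)
Lemma mass_increment_derivative chi t0 : 0 < t0 -> test1 chi ->
  let d t := \int[mu]_x (u t x * chi x) - \int[mu]_x (u t x * chi (2 * b t0 - x)) in
  k^-1 * d (t0 + k) @[k --> (0 : R)^'] --> 2 * dd b t0 * \int[mu]_x (u t0 x * dd chi x).
Proof.
move=> t00 tc d; pose a0 := 2 * b t0; pose h t := 2 * b t - a0.
pose q := diffq chi (dd chi).
pose J t := \int[mu]_x (u t x * q (h t) (a0 - x)).
have cb : continuous b := has_deriv_continuous (derivable_has_deriv Cb.1).
have h0 : h t @[t --> t0] --> (0 : R).
  by rewrite -(subrr a0); apply: cvgB; [apply: cvgMr; exact: cb|exact: cvg_cst].
have qc : L2cvg (nbhs t0) (fun t x => q (h t) (a0 - x)) (fun x => dd chi (a0 - x)).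
  by apply: (L2cvg_refl (k := fun t => q (h t))); exact: L2cvg_comp (diffq_L2cvg tc) h0.
have [uc _] := C_H1_L2cvg Hu t00.
have JJ : J t @[t --> t0] --> \int[mu]_x (u t0 x * dd chi x).
  rewrite -(mass_refl (ltW t00) (test1_derive1 tc)).
  exact: L2cvgM uc qc.
have dE t : 0 <= t -> d t = h t * J t.
  move=> tge; have Lut := Lu tge.
  rewrite /d -(mass_refl tge tc) -RintB; last 2 first.
  - by apply: L2M_intg => //; apply: L2_refl; exact: test1_L2.
  - by apply: L2M_intg => //; apply: L2_refl; exact: test1_L2.
  have [ht|ht] := eqVneq (h t) 0.
    have E : 2 * b t = a0 by apply/eqP; rewrite -subr_eq0 -/(h t) ht.
    rewrite ht mul0r -(mul0r (\int[mu]_x (u t x * chi x))) -RintZl; last first.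
      by apply: L2M_intg => //; exact: test1_L2.
    by apply: Rint_eq => x; rewrite E subrr mul0r.
  rewrite /J -RintZl; last first.
    apply: L2M_intg => //; apply: (L2_refl a0 (f := q (h t))).
    rewrite /q /diffq (negbTE ht).
    have := L2Zl (h t)^-1 (L2B (L2_shift (- h t) (test1_L2 tc)) (test1_L2 tc)).
    by under eq_fun do rewrite opprK mulrC.
  apply: Rint_eq => x; rewrite mulrCA -(diffqE chi (dd chi)) -mulrBr.
  by congr (_ * (chi _ - _)); rewrite /h; ring.
have Jk : J (t0 + k) @[k --> (0 : R)^'] --> \int[mu]_x (u t0 x * dd chi x).
  apply: cvg_within_filter.
  apply: (@cvg_comp _ _ _ (fun k => t0 + k) J _ (nbhs t0)); last exact: JJ.
  have H : (t0 + k) @[k --> (0 : R)] --> t0 + 0 by apply: cvgD; [exact: cvg_cst|exact: cvg_id].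
  by rewrite addr0 in H.
have hk : k^-1 * h (t0 + k) @[k --> (0 : R)^'] --> 2 * dd b t0.
  have H : 2 * (k^-1 * (b (t0 + k) - b t0)) @[k --> (0 : R)^'] --> 2 * dd b t0.
    by apply: cvgMr; exact: C1_lim.
  apply: cvg_trans H; apply: near_eq_cvg; near=> k.
  by rewrite /h /a0; ring.
have H : (k^-1 * h (t0 + k)) * J (t0 + k) @[k --> (0 : R)^'] -->
    2 * dd b t0 * \int[mu]_x (u t0 x * dd chi x) by exact: cvgM hk Jk.
apply: cvg_trans H; apply: near_eq_cvg; near=> k.
rewrite dE ?mulrA//.
(* Keeps [t0 + k] nonnegative, where the symmetry is available. *)
have : `|k| < t0.
  by near: k; apply: (@cvg_within _ (nbhs (0 : R))); exact: near0_norm.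
by rewrite ltr_norml => /andP[]; lra.
Unshelve. all: by end_near. Qed.

Lemma flux_identity t0 psi : 0 < t0 -> test1 psi ->
  flux (u t0) (v t0) (w t0) (ux t0) (vx t0) (wx t0) psi =
  dd b t0 * \int[mu]_x (u t0 x * (dd psi x - dd (dd (dd psi)) x)).
Proof.
move=> t00 tp.
have tp1 := test1_derive1 tp; have tp2 := test1_derive1 tp1; have tp3 := test1_derive1 tp2.
pose a0 := 2 * b t0; pose psi0 x := psi (a0 - x).
have tp0 : test1 psi0 by exact: test1_refl.
pose chi x := psi x - dd (dd psi) x.
have tchi : test1 chi by exact: test1B.
have chi1 : dd chi = fun x => dd psi x - dd (dd (dd psi)) x.
  exact: (has_deriv_derive1 (has_derivB (smooth1_has_deriv tp.1) (smooth1_has_deriv tp2.1))).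
(* [1 - d_x^2] commutes with reflection, so [d] below is the difference of the masses of [psi] and
   of its reflection, and its weak derivative is the difference of the fluxes. *)
have chi0 x : psi0 x - dd (dd psi0) x = chi (a0 - x).
  by rewrite /psi0 (refl_derive2 a0 tp.1).
pose d t := \int[mu]_x (u t x * chi x) - \int[mu]_x (u t x * chi (a0 - x)).
pose N p t := flux (u t) (v t) (w t) (ux t) (vx t) (wx t) p.
have r0 : 0 < t0 / 2 by rewrite divr_gt0.
have cd t : 0 < t -> {for t, continuous d}.
  move=> tgt; apply: cvgB; first exact: (mass_continuous Hu tgt (test1_L2 tchi)).
  exact: (mass_continuous Hu tgt (L2_refl a0 (test1_L2 tchi))).
have cN t : 0 < t -> {for t, continuous (fun t => N psi t - N psi0 t)}.
  by move=> tgt; apply: cvgB; exact: (flux_continuous Hu Hv Hw tgt).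
(* The radius [t0 / 2] confines the time test functions to positive times. *)
have key := @weak_derivative_at R d (fun t => N psi t - N psi0 t) t0
  (2 * dd b t0 * \int[mu]_x (u t0 x * dd chi x)) (t0 / 2) r0.
have EN0 : N psi0 t0 = - N psi t0.
  apply: flux_refl => //; [exact: Hu.1 (ltW t00)|exact: Hv.1 (ltW t00)|exact: Hw.1 (ltW t00)|].
  exact: sym (ltW t00).
suff E : 2 * dd b t0 * \int[mu]_x (u t0 x * dd chi x) = N psi t0 - N psi0 t0.
  have I0E : \int[mu]_x (u t0 x * dd chi x) =
      \int[mu]_x (u t0 x * (dd psi x - dd (dd (dd psi)) x)).
    exact: Rint_eq (fun x => congr1 (fun p => u t0 x * p x) chi1).
  by rewrite -I0E; exact: double_cancel E EN0.
apply: key.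
- move=> t tt; have tgt := half_pos tt.
  by split; [exact: cd|exact: cN].
- by apply/eqP; rewrite subr_eq0 eq_sym; apply/eqP; exact: (mass_refl (ltW t00) tchi).
- exact: (mass_increment_derivative t00 tchi).
move=> theta tt [rho rhor th0].
have ta := half_pos' t00 rhor.
have th1 := derive1_supp th0; have tt1 := test1_derive1 tt.
have W1 := weak_eq_prod Hu Hv Hw ta tt tp th0 (Hweak (test2_prod ta tt tp th0)).
have W2 := weak_eq_prod Hu Hv Hw ta tt tp0 th0 (Hweak (test2_prod ta tt tp0 th0)).
have i1 : intg (fun t => dd theta t * \int[mu]_x (u t x * chi x)).
  by apply: (supp_intg ta tt1 th1) => t tgt; exact: (mass_continuous Hu tgt (test1_L2 tchi)).
have i2 : intg (fun t => dd theta t * \int[mu]_x (u t x * (psi0 x - dd (dd psi0) x))).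
  apply: (supp_intg ta tt1 th1) => t tgt; apply: (mass_continuous Hu tgt).
  exact: (L2B (test1_L2 tp0) (test1_L2 (test1_derive1 (test1_derive1 tp0)))).
have i3 p : test1 p -> intg (fun t => theta t * N p t).
  by move=> tp'; apply: (supp_intg ta tt th0) => t tgt; exact: (flux_continuous Hu Hv Hw tgt).
have Z := etrans (RintB (intgD i1 (i3 _ tp)) (intgD i2 (i3 _ tp0)))
  (etrans (congr2 (fun y z => y - z) W1 W2) (subrr 0)).
apply: etrans Z; apply: Rint_eq => t.
have chiE : \int[mu]_x (u t x * chi (a0 - x)) =
    \int[mu]_x (u t x * (psi0 x - dd (dd psi0) x)).
  exact: Rint_eq (fun x => congr1 (fun z => u t x * z) (esym (chi0 x))).
apply: etrans (congr1 (fun z => dd theta t * (\int[mu]_x (u t x * chi x) - z) +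
  theta t * (N psi t - N psi0 t)) chiE) _.
exact: regroup.
Qed.

End SymmetricFlux.

(** * Travelling waves *)

Section TravellingWave.
Context {R : realType}.
Notation mu := (@lebesgue_measure R).
Notation dd f := (derive1 (f : R -> R^o)).

Let add_flux (i j k l m : R) : j - 2^-1 * k + l = m -> i + j - 2^-1 * k + l = i + m.
Proof. by move=> <-; ring. Qed.

Let factor_flux (y f c k l : R) : y * f + c * (y * (k - l)) = y * (f + c * (k + (-1) * l)).
Proof. by ring. Qed.

Lemma ccont2_lin (a : R) (f g : R -> R -> R) : ccont2 f -> ccont2 g -> ccont2 (fun t x => f t x + a * g t x).
Proof.
move=> [cf [T1 [T2 [X [T10 f0]]]]] [cg [S1 [S2 [Y [S10 g0]]]]]; split.
  by move=> p; apply: cvgD; [exact: cf|apply: cvgMr; exact: cg].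
exists (Num.min T1 S1), (Num.max T2 S2), (Num.max X Y); split; first by rewrite lt_min T10.
move=> t x; rewrite lt_min !gt_max => H.
rewrite f0 ?g0 ?mulr0 ?addr0//.
- by case: H => [/andP[? ?]|[/andP[? ?]|/andP[? ?]]]; [left|right; left|right; right].
- by case: H => [/andP[? ?]|[/andP[? ?]|/andP[? ?]]]; [left|right; left|right; right].
Qed.

Lemma smooth2_smooth1 (phi : R -> R -> R) t : smooth2 phi -> smooth1 (phi t).
Proof.
move=> sp n x; have [_ /(_ t x)[_ H]] := sp (nseq n false).
suff <- : (fun y => Dw (nseq n false) phi t y) = iter n (@derive1 R R^o) (phi t) by [].
by elim: n {H} => // n IH; rewrite [RHS]/= -IH.
Qed.

Lemma shift_derive1 (f : R -> R) (s : R) : smooth1 f ->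
  dd (fun y => f (y + s)) = fun y => dd f (y + s).
Proof. by move=> sf; exact: (has_deriv_derive1 (has_deriv_shift s (smooth1_has_deriv sf))). Qed.

Lemma test1_shift (f : R -> R) (s : R) : test1 f -> test1 (fun y => f (y + s)).
Proof.
move=> tf; have := @test1_refl _ 0 _ (@test1_refl _ s _ tf).
rewrite (_ : (fun x => f (s - (0 - x))) = fun y => f (y + s))//.
by apply/funext => y; congr f; ring.
Qed.

Lemma test2_test1 (phi : R -> R -> R) t : test2 phi -> test1 (phi t).
Proof.
move=> [sp [T1 [T2 [X [_ p0]]]]]; split; first exact: smooth2_smooth1.
by exists X => x xX; apply: p0; right; right.
Qed.

(** Again two reflections; the two signs cancel. *)
Lemma weak_deriv_shift (f g : R -> R) a : L2 f -> L2 g -> weak_deriv f g ->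
  weak_deriv (fun x => f (x - a)) (fun x => g (x - a)).
Proof.
move=> Lf Lg H; have H1 := weak_deriv_refl (- a) Lf Lg H.
have L1 := L2_refl (- a) Lf.
have L2' : L2 (fun x => - g (- a - x)).
  by have := L2Zl (-1) (L2_refl (- a) Lg); under eq_fun do rewrite mulN1r.
have := weak_deriv_refl 0 L1 L2' H1.
rewrite (_ : (fun x => f (- a - (0 - x))) = fun x => f (x - a)); last first.
  by apply/funext => x; congr f; ring.
by rewrite (_ : (fun x => - - g (- a - (0 - x))) = fun x => g (x - a))//;
  apply/funext => x; rewrite opprK; congr g; ring.
Qed.

(** Only the position of the profile depends on time, so continuity into H1 is continuity of
    translations in L2, for the profile and for its weak derivative, with [e / 2] each. *)
Lemma travelling_C_H1 (f g : R -> R) (c t0 : R) : H1 f g ->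
  C_H1 (fun t x => f (x - c * (t - t0))) (fun t x => g (x - c * (t - t0))).
Proof.
move=> [Lf [Lg H]]; split.
  by move=> t _; split; [exact: L2_shift|split; [exact: L2_shift|exact: weak_deriv_shift]].
move=> t1 _ e e0.
have sc : (c * (s - t0)) @[s --> t1] --> c * (t1 - t0).
  by apply: cvgMr; apply: cvgB; [exact: cvg_id|exact: cvg_cst].
have [Lf1 Lf0 cf] := L2cvg_comp (L2_shift_cvg (c * (t1 - t0)) Lf) sc.
have [Lg1 Lg0 cg] := L2cvg_comp (L2_shift_cvg (c * (t1 - t0)) Lg) sc.
have e2 : 0 < e / 2 by rewrite divr_gt0.
have n1 : \forall s \near t1, \int[mu]_x (f (x - c * (s - t0)) - f (x - c * (t1 - t0))) ^+ 2 < e / 2.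
  exact: (cvgr_lt 0 cf).
have n2 : \forall s \near t1, \int[mu]_x (g (x - c * (s - t0)) - g (x - c * (t1 - t0))) ^+ 2 < e / 2.
  exact: (cvgr_lt 0 cg).
have n3 : \forall s \near t1, H1dist2 (fun x => f (x - c * (s - t0))) (fun x => g (x - c * (s - t0)))
    (fun x => f (x - c * (t1 - t0))) (fun x => g (x - c * (t1 - t0))) < e.
  near=> s; rewrite /H1dist2 RintD.
  - have h1 : \int[mu]_x (f (x - c * (s - t0)) - f (x - c * (t1 - t0))) ^+ 2 < e / 2 by near: s.
    have h2 : \int[mu]_x (g (x - c * (s - t0)) - g (x - c * (t1 - t0))) ^+ 2 < e / 2 by near: s.
    lra.
  - exact: (L2_sqr (L2B (L2_shift _ Lf) Lf0)).
  - exact: (L2_sqr (L2B (L2_shift _ Lg) Lg0)).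
case/nbhs_ballP : n3 => del /= del0 Hd; exists del; split => // s _ sd.
by apply: Hd; rewrite /ball/= distrC.
Unshelve. all: by end_near. Qed.

Lemma pairing_travelling (G : R -> R) (f : R -> R -> R) (c t0 : R) : locint G -> ccont2 f ->
  pairing (fun t x => G (x - c * (t - t0))) f =
  \int[mu]_(t in [set t | 0 <= t]) (\int[mu]_x (G x * f t (x + c * (t - t0)))).
Proof.
move=> lG cf; rewrite /pairing; apply: eq_Rintegral => t _.
rewrite -(@Rint_shift _ (c * (t - t0)) (fun x => G x * f t (x + c * (t - t0)))).
  by apply: Rint_eq => x; rewrite subrK.
exact: (ccont2_intg t lG (ccont2_shift c t0 cf)).
Qed.

Lemma RintegralD3 (D : set R) (f1 f2 f3 f4 : R -> R) : measurable D ->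
  mu.-integrable D (EFin \o f1) -> mu.-integrable D (EFin \o f2) ->
  mu.-integrable D (EFin \o f3) -> mu.-integrable D (EFin \o f4) ->
  \int[mu]_(t in D) f1 t + \int[mu]_(t in D) f2 t - 2^-1 * \int[mu]_(t in D) f3 t
    + \int[mu]_(t in D) f4 t =
  \int[mu]_(t in D) (f1 t + f2 t - 2^-1 * f3 t + f4 t).
Proof.
move=> mD i1 i2 i3 i4.
have mD' : measurable (D : set (measurableTypeR R)) by exact: mD.
have i3' : mu.-integrable D (EFin \o (fun t => 2^-1 * f3 t)).
  by have := integrableZl mD' 2^-1 i3; exact: eq_integrable.
have i12 : mu.-integrable D (EFin \o (fun t => f1 t + f2 t)).
  by have := integrableD mD' i1 i2; exact: eq_integrable.
have i123 : mu.-integrable D (EFin \o (fun t => f1 t + f2 t - 2^-1 * f3 t)).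
  by have := integrableB mD' i12 i3'; exact: eq_integrable.
by rewrite (RintegralD mD' i123 i4) (RintegralB mD' i12 i3') (RintegralD mD' i1 i2) (RintegralZl _ mD' i3).
Qed.

(** The translation is moved onto the test function. At each time the spatial terms then form a
    flux, which the hypothesis turns into [c] times a pairing with [u]. Together with the time term
    this is the integral of [u] against the time derivative of [(1 - d_x^2) phi] along lines of
    speed [c], and integrating over time gives [0]. *)
Lemma travelling_weak_eq (u v w ux vx wx : R -> R) (c t0 : R) :
  H1 u ux -> H1 v vx -> H1 w wx ->
  (forall psi, test1 psi -> flux u v w ux vx wx psi =
     c * \int[mu]_x (u x * (dd psi x - dd (dd (dd psi)) x))) ->
  forall phi, test2 phi ->
  weak_eq (fun t x => u (x - c * (t - t0))) (fun t x => v (x - c * (t - t0)))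
    (fun t x => w (x - c * (t - t0))) (fun t x => ux (x - c * (t - t0)))
    (fun t x => vx (x - c * (t - t0))) (fun t x => wx (x - c * (t - t0))) phi.
Proof.
move=> [Lu [Lux _]] [Lv [Lvx _]] [Lw [Lwx _]] Hflux phi tphi; have sphi := tphi.1.
have lu := L2_locint Lu.
have lA := intg_locint (flA_intg Lv Lw Lux); have lB := intg_locint (flB_intg Lu).
have lC := intg_locint (flC_intg Lu Lv Lw Lux Lvx Lwx).
pose f1 t x := dt phi t x + (-1) * dx (dx (dt phi)) t x.
have c1 : ccont2 f1 by apply: ccont2_lin; [exact: (test2_ccont2 [:: true] tphi)|exact: (test2_ccont2 [:: false; false; true] tphi)].
have c2 : ccont2 (dx (dx phi)) by exact: (test2_ccont2 [:: false; false] tphi).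
have c3 : ccont2 (dx (dx (dx phi))) by exact: (test2_ccont2 [:: false; false; false] tphi).
have c4 : ccont2 (dx phi) by exact: (test2_ccont2 [:: false] tphi).
have c0 : ccont2 phi by exact: (test2_ccont2 [::] tphi).
have f1E : (fun t x => dt phi t x - dx (dx (dt phi)) t x) = f1.
  by apply/funext => t; apply/funext => x; rewrite /f1 mulN1r.
rewrite /weak_eq f1E.
have EB := pairing_travelling c t0 lB c3; rewrite /flB in EB; rewrite EB {EB}.
have EA := pairing_travelling c t0 lA c2; rewrite /flA in EA; rewrite EA {EA}.
have EC := pairing_travelling c t0 lC c4; rewrite /flC in EC; rewrite EC {EC}.
rewrite (pairing_travelling c t0 lu c1).
rewrite -/(flB u) -/(flA v w ux) -/(flC u v w ux vx wx).
have s1 := ccont2_shift c t0 c1; have s2 := ccont2_shift c t0 c2.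
have s3 := ccont2_shift c t0 c3; have s4 := ccont2_shift c t0 c4.
rewrite RintegralD3; [|exact: nonneg_measurable|exact: ccont2_time_intg|exact: (ccont2_time_intg lA s2)
  |exact: (ccont2_time_intg lB s3)|exact: (ccont2_time_intg lC s4)].
(* [K] is [(1 - d_x^2) phi]; its derivatives are [f1] in time and [K_x] in space, and [P] below is
   its total derivative along a line of speed [c]. *)
pose K t x := phi t x + (-1) * dx (dx phi) t x.
pose K_x t x := dx phi t x + (-1) * dx (dx (dx phi)) t x.
have cK : ccont2 K by exact: ccont2_lin.
have cKx : ccont2 K_x by exact: ccont2_lin.
have dKt x : has_deriv (K ^~ x) (f1 ^~ x).
  have H := has_derivD (smooth2_has_deriv_t [::] x sphi) (has_derivZ (-1) (smooth2_has_deriv_t [:: false; false] x sphi)).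
  (* [dt] is moved past [dx] twice. *)
  have E : dt (dx (dx phi)) = dx (dx (dt phi)).
    by rewrite -(smooth2_comm [:: false] sphi) -(smooth2_comm [::] sphi).
  by move: H; rewrite /= E.
have dKx t : has_deriv (K t) (K_x t).
  exact: has_derivD (smooth2_has_deriv_x [::] t sphi) (has_derivZ (-1) (smooth2_has_deriv_x [:: false; false] t sphi)).
pose P t x := f1 t (x + c * (t - t0)) + c * K_x t (x + c * (t - t0)).
have cP : ccont2 P by apply: ccont2_lin; exact: ccont2_shift.
have dP x : has_deriv (fun t => K t (x + c * (t - t0))) (P ^~ x).
  exact: (has_deriv_along c t0 x dKt dKx c1.1).
rewrite -[RHS](ccont2_time_int lu (ccont2_shift c t0 cK) cP dP).
apply: eq_Rintegral => t _; set s := c * (t - t0).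
pose psi y := phi t (y + s).
have tp : test1 psi by exact: (test1_shift s (test2_test1 t tphi)).
have st : smooth1 (phi t) by exact: smooth2_smooth1.
have p1 : dd psi = fun y => dx phi t (y + s) by exact: shift_derive1.
have p2 : dd (dd psi) = fun y => dx (dx phi) t (y + s).
  by rewrite p1; exact: (shift_derive1 s (smooth1_derive1 st)).
have p3 : dd (dd (dd psi)) = fun y => dx (dx (dx phi)) t (y + s).
  by rewrite p2; exact: (shift_derive1 s (smooth1_derive1 (smooth1_derive1 st))).
have R1 : \int[mu]_x (u x * (dd psi x - dd (dd (dd psi)) x)) =
    \int[mu]_x (u x * (dx phi t (x + s) - dx (dx (dx phi)) t (x + s))).
  exact: Rint_eq (fun x => congr2 (fun k l => u x * (k x - l x)) p1 p3).
have E := etrans (esym (fluxE _ _ _ _ _ _ p1 p2 p3))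
  (etrans (Hflux psi tp) (congr1 (fun z => c * z) R1)).
have tq1 := eq_ind _ (@test1 R) (test1_derive1 tp) _ p1.
have tq3 := eq_ind _ (@test1 R) (test1_derive1 (test1_derive1 (test1_derive1 tp))) _ p3.
have j2 := L2M_intg Lu (L2B (test1_L2 tq1) (test1_L2 tq3)).
have j1 := ccont2_intg t lu s1.
apply: etrans (add_flux _ E) _.
apply: etrans (congr1 (fun z => _ + z) (esym (RintZl c j2))) _.
apply: etrans (esym (RintD j1 (intgZl c j2))) _.
by apply: Rint_eq => x; exact: factor_flux.
Qed.

End TravellingWave.

Theorem theorem4p1 (R : realType) (u v w : R -> R -> R) :
  weak_solution u v w -> x_symmetric u v w -> unique_weak_solution u v w ->
  traveling_wave u v w.
Proof.
move=> [ux [vx [wx [Hu [Hv [Hw Hweak]]]]]] [b [Cb sym]] uniq.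
have t1 : 0 < (1 : R) by exact: ltr01.
have t1' := ltW t1.
pose c := derive1 (b : R -> R^o) 1.
have hu := Hu.1 1 t1'; have hv := Hv.1 1 t1'; have hw := Hw.1 1 t1'.
have Fu psi := flux_identity Hu Hv Hw (fun phi tp => (Hweak phi tp).1) Cb sym (psi := psi) t1.
have symv t : 0 <= t -> {ae (@lebesgue_measure R), forall x, v t x = v t (2 * b t - x) /\
    u t x = u t (2 * b t - x) /\ w t x = w t (2 * b t - x)}.
  by move=> t0; apply: ae_mono (sym t t0) _ => x [? []].
have symw t : 0 <= t -> {ae (@lebesgue_measure R), forall x, w t x = w t (2 * b t - x) /\
    u t x = u t (2 * b t - x) /\ v t x = v t (2 * b t - x)}.
  by move=> t0; apply: ae_mono (sym t t0) _ => x [? []].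
(* The equation for [v] is the first one with the components in the order [v], [u], [w], so the
   symmetry is supplied in that order too. The axis [b], hence the speed, is unchanged. *)
have Fv psi := flux_identity Hv Hu Hw (fun phi tp => (Hweak phi tp).2.1) Cb symv (psi := psi) t1.
have Fw psi := flux_identity Hw Hu Hv (fun phi tp => (Hweak phi tp).2.2) Cb symw (psi := psi) t1.
have sol : weak_solution (fun t x => u 1 (x - c * (t - 1))) (fun t x => v 1 (x - c * (t - 1)))
    (fun t x => w 1 (x - c * (t - 1))).
  exists (fun t x => ux 1 (x - c * (t - 1))), (fun t x => vx 1 (x - c * (t - 1))),
    (fun t x => wx 1 (x - c * (t - 1))).
  split; [exact: travelling_C_H1|split; [exact: travelling_C_H1|split; [exact: travelling_C_H1|]]].
  by move=> phi tphi; split; [|split]; apply: travelling_weak_eq.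
(* The components at time 1 are the profiles. Agreement at time 1 determines the solution at every
   nonnegative time, earlier ones included. *)
exists c, 1, (u 1), (v 1), (w 1); split => // t t0.
have := uniq _ _ _ sol 1 t1' _ t t0.
move=> /(_ _)/ae_mono; apply; last by move=> x [-> [-> ->]].
by apply: aeW => x; rewrite subrr mulr0 subr0.
Qed.
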